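(* For $n\ge 3$ and $F\in\{M_1,D_1,S_1\}$, let $t(n,F)$ be the maximum of $|\mathcal{T}|$ over all $n$-point triangle systems $(P,\mathcal{T})$ not containing $F$. Then $$t(n,D_1)=\Delta^{\bullet}(n),\qquad t(n,S_1)=\Delta^{\bullet}(n)+\Big\lfloor\frac n2\Big\rfloor\Big\lfloor\frac{n-2}{2}\Big\rfloor,\qquad t(n,M_1)=\Delta^{\bullet}(n)+\Theta(n^2)\ \ (n\to\infty),$$ where the first two equalities hold for all $n\ge 3$, and the last one means that there are constants $c,C>0$ with $cn^2\le t(n,M_1)-\Delta^{\bullet}(n)\le Cn^2$ for all sufficiently large $n$.
   Context: A triangle is a closed set, namely the convex hull of three non-collinear points. An $n$-point triangle system is a pair $(P,\mathcal{T})$ where $P$ is a set of $n$ points in the plane with no three collinear and $\mathcal{T}$ is a set of triangles with vertices from $P$. The system contains a configuration $F$ if some two triangles of $\mathcal{T}$ form $F$, where: - $D_1$: two triangles sharing a side and lying on opposite sides of the line through that side. - $S_1$: two triangles whose intersection is exactly one point, which is a common vertex. - $M_1$: two triangles sharing no points (disjoint as closed sets). Finally, $\Delta^{\bullet}(n)=\frac{n(n-1)(n+1)}{24}$ if $n$ is odd and $\Delta^{\bullet}(n)=\frac{n(n-2)(n+2)}{24}$ if $n$ is even. *)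

(* Defs.v *)
From HB Require Import structures.
From mathcomp Require Import all_boot all_order all_algebra.
From mathcomp Require Import finmap.
From mathcomp Require Import boolp classical_sets reals.
From mathcomp Require Import ring lra.

Set Implicit Arguments.
Unset Strict Implicit.
Unset Printing Implicit Defensive.

Import Order.TTheory GRing.Theory Num.Theory.
Local Open Scope fset_scope.
Local Open Scope classical_set_scope.
Local Open Scope ring_scope.

Section TriangleSystems.
Variable R : realType.

Definition plane := 'rV[R]_2.

Implicit Types (p q r s : plane) (A B : set plane).
Implicit Types (P : {fset plane}) (T : {fset set plane}).

Definition dot (u p : plane) : R := \sum_i u 0 i * p 0 i.

(* For u != 0, the line with normal vector u and offset c; its two sides are  *)
(* [set x | dot u x < c] and [set x | c < dot u x].                           *)
Definition line (u : plane) (c : R) : set plane := [set x | dot u x = c].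

Definition collinear p q r :=
  exists (u : plane) (c : R),
    [/\ u != 0, line u c p, line u c q & line u c r].

Definition hull3 p q r : set plane :=
  [set x | exists a b c : R,
    [/\ 0 <= a, 0 <= b, 0 <= c, a + b + c = 1 &
        x = a *: p + b *: q + c *: r]].

(* A is a triangle with vertices p, q, r; the vertices of a triangle are its  *)
(* extreme points, so A determines them up to order.                          *)
Definition triangle p q r A := ~ collinear p q r /\ A = hull3 p q r.

Definition triangle_system P T :=
  (forall p q r, p \in P -> q \in P -> r \in P ->
     p != q -> p != r -> q != r -> ~ collinear p q r) /\
  (forall A, A \in T ->
     exists p q r, [/\ p \in P, q \in P, r \in P & triangle p q r A]).

Definition configuration := set plane -> set plane -> Prop.

Definition D1 : configuration := fun A B =>
  exists p q r s, [/\ triangle p q r A, triangle p q s B &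
    exists (u : plane) (c : R),
      [/\ u != 0, line u c p, line u c q, dot u r < c & c < dot u s]].

Definition S1 : configuration := fun A B =>
  exists p q r q' r',
    [/\ triangle p q r A, triangle p q' r' B & A `&` B = [set p]].

Definition M1 : configuration := fun A B => A `&` B = set0.

Definition contains T (F : configuration) :=
  exists A B, [/\ A \in T, B \in T, A != B & F A B].

Definition avoiding_size n (F : configuration) : set nat :=
  [set m | exists P T, [/\ #|` P| = n, triangle_system P T,
     ~ contains T F & #|` T| = m]].

Definition maximum (S : set nat) : set nat :=
  [set m | S m /\ forall k, S k -> (k <= m)%N].

Definition turan n (F : configuration) : nat :=
  xget 0%N (maximum (avoiding_size n F)).

Lemma turanP n (F : configuration) : maximum (avoiding_size n F) (turan n F).
Proof.
pose pt (i : 'I_n) : plane := \row_j (i%:R ^+ j.+1).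
have ptE (u : plane) i : dot u (pt i) = u 0 0 * i%:R + u 0 1 * i%:R ^+ 2.
  by rewrite /dot !big_ord_recl big_ord0 addr0 !mxE /= expr1; congr (_ + u _ _ * _);
     apply/val_inj.
have pt_inj : injective pt.
  move=> i j /rowP /(_ 0); rewrite !mxE !expr1 => /eqP.
  by rewrite eqr_nat => /eqP/val_inj.
apply: xgetPex.
have S0 : avoiding_size n F 0.
  exists [fset pt i | i in 'I_n], fset0; split; last by rewrite cardfs0.
  - by rewrite card_imfset //= size_enum_ord.
  - split=> [p q r|A]; last by rewrite inE.
    move=> /imfsetP[i _ ->] /imfsetP[j _ ->] /imfsetP[k _ ->].
    rewrite !(inj_eq pt_inj) => ij ik jk [u [c [u0]]].
    rewrite /line /= !ptE => ei ej ek.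
    have nz (a b : 'I_n) : a != b -> (a%:R - b%:R : R) != 0.
      by move=> ab; rewrite subr_eq0 eqr_nat.
    have e1 : u 0 0 + u 0 1 * (i%:R + j%:R) = 0.
      apply: (mulfI (nz _ _ ij)); rewrite mulr0; lra.
    have e2 : u 0 0 + u 0 1 * (i%:R + k%:R) = 0.
      apply: (mulfI (nz _ _ ik)); rewrite mulr0; lra.
    have u1 : u 0 1 = 0 by apply: (mulfI (nz _ _ jk)); rewrite mulr0; lra.
    have u00 : u 0 0 = 0 by move: e1; rewrite u1 mul0r addr0.
    move/eqP: u0; apply; apply/rowP => a; rewrite mxE.
    case: a => -[|[|//]] h; [rewrite -[RHS]u00|rewrite -[RHS]u1];
      by congr (u _ _); apply: val_inj.
  - by move=> [A [B []]]; rewrite inE.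
have Sb m : avoiding_size n F m -> (m <= n * n * n)%N.
  move=> [P [T [<- [_ TP] _ <-]]].
  pose h (x : P * P * P) := hull3 (val x.1.1) (val x.1.2) (val x.2).
  have -> : (#|` P| * #|` P| * #|` P| = #|{: P * P * P}|)%N.
    by rewrite !card_prod -cardfE.
  have TS : (T `<=` [fset h x | x in {: P * P * P}])%fset.
    apply/fsubsetP => A /TP[p [q [r [pP qP rP [_ ->]]]]].
    by apply/imfsetP; exists ([` pP], [` qP], [` rP]).
  apply: (leq_trans (fsubset_leq_card TS)).
  by apply: (leq_trans (leq_imfset_card _ _ _)); rewrite cardE.
have ex : exists m, `[< avoiding_size n F m >] by exists 0%N; apply/asboolP.
have ub m : `[< avoiding_size n F m >] -> (m <= n * n * n)%N by move=> /asboolP/Sb.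
case: (ex_maxnP ex ub) => m /asboolP Sm mmax; exists m; split=> // k Sk.
exact/mmax/asboolP.
Qed.

End TriangleSystems.

(* Both divisions are exact.                                                  *)
Definition Delta (n : nat) : nat :=
  (if odd n then n * (n - 1) * (n + 1) %/ 24
   else n * (n - 2) * (n + 2) %/ 24)%N.

(* Main.v *)
Require Import Defs.
From HB Require Import structures.
From mathcomp Require Import all_boot all_order all_algebra.
From mathcomp Require Import finmap.
From mathcomp Require Import boolp classical_sets reals.
From mathcomp Require Import zify ring lra.

Set Implicit Arguments.
Unset Strict Implicit.
Unset Printing Implicit Defensive.

Import Order.TTheory GRing.Theory Num.Theory.
Local Open Scope ring_scope.

(* Upper bounds.  Orient p -> q when some triangle of T has the side pq and   *)
(* lies to the left of the vector pq.  If T avoids D1, this is an oriented    *)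
(* graph in which every triangle of T is a directed cycle, and a tournament   *)
(* on n vertices has at most Delta n cyclic triangles.  For S1 and M1 it is   *)
(* enough to delete few triangles so that D1 is avoided.                      *)
(* For M1, delete pqr (counterclockwise) when no triangle of T at p lies      *)
(* strictly to the left of pq: for given p and r this happens for at most one *)
(* q, and if pqr and qps both survive, the witnesses at p and at q are        *)
(* disjoint.                                                                  *)
(* For S1, call pq double if T has triangles on both of its sides.  At each   *)
(* endpoint p, deleting at most (n - 2)/2 triangles settles all double edges  *)
(* at p, except when these edges form a star centred at p, where twice as     *)
(* many suffice but at least four vertices are used up.  Away from the stars  *)
(* the double edges turn alternately left and right along a path, so they     *)
(* form a bipartite graph, and p need only run over its smaller colour class. *)
(* Lower bounds.  Put points (t, 1/t) on the hyperbola at t = (-1)^i tau(i)   *)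
(* and take triangles containing the origin: for D1, tau is strictly          *)
(* increasing; for S1 and M1, consecutive points are paired into antipodes.   *)

(** * Cyclic triangles in tournaments *)

(** Triangles are counted as ordered counterclockwise triples, three per triangle. In a tournament
    in-degree and out-degree add up to n - 1, so the number of cyclic triples is determined by the
    sum of in-degree times out-degree; balancing the degrees gives [tournament_cyclic_le]. By
    [deletion_bound], if deleting k triangles leaves no side with triangles on both of its sides,
    the whole system has at most [Delta n + k] triangles.

    Each upper bound is then a deletion count: nothing for D1; one triangle per ordered pair (p, r)
    for M1 ([opposite_bound]); for S1 at most n/2 responsible vertices, star centres counted twice,
    each charged (n - 2)/2 ([meeting_deletion]). These arguments see the plane only through the
    axioms [orientation], which [ccw_orientation] derives from determinant identities.

    For the lower bounds, index triples of alternating parity give triangles containing the origin,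
    exactly [Delta n] of them ([sum_Delta24]). If the origin is interior to all of them, D1 cannot
    occur. Admitting every triangle with an antipodal pair adds exactly the S1 correction term
    ([sum_paired_total]); all triangles then share a point that is no vertex, which excludes both S1
    and M1. *)

Definition Delta24 (n : nat) : nat :=
  (if odd n then n * (n - 1) * (n + 1) else n * (n - 2) * (n + 2))%N.

Lemma DeltaE n : Delta n = (Delta24 n %/ 24)%N.
Proof. by rewrite /Delta /Delta24; case: odd. Qed.

Section Tournament.
Local Open Scope nat_scope.
Variables (V : finType) (a : rel V).
Hypothesis a_irr : irreflexive a.
Hypothesis a_tour : forall p q, p != q -> a p q = ~~ a q p.

Let out p := \sum_q a p q.
Let inn p := \sum_q a q p.
Let cyc := \sum_p \sum_q \sum_r a p q * a q r * a r p.
Let trans := \sum_p \sum_q \sum_r a p q * a q r * a p r.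

Lemma out_inn p : out p + inn p = #|V| - 1.
Proof.
rewrite /out /inn -big_split /= (bigD1 p) //= a_irr add0n.
rewrite (eq_bigr (fun=> 1)) => [|q qp]; last first.
  by rewrite a_tour 1?eq_sym //; case: (a q p).
by rewrite sum_nat_const muln1 subn1 -(cardC1 p).
Qed.

(** A path p -> q -> r closes to a cyclic or a transitive triple according to the direction of the
    arc between r and p. *)
Lemma sum_inn_out : \sum_q inn q * out q = cyc + trans.
Proof.
rewrite /cyc exchange_big /trans [X in _ + X]exchange_big -big_split /=.
apply: eq_bigr => q _; rewrite -big_split /= /inn big_distrl /=.
apply: eq_bigr => p _; rewrite /out big_distrr -big_split /=.
apply: eq_bigr => r _.
have [->|pr] := eqVneq p r.
  rewrite a_irr !muln0; have [->|rq] := eqVneq r q; first by rewrite a_irr.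
  by rewrite a_tour //; case: (a q r).
by rewrite (a_tour pr) -mulnDr; case: (a r p); rewrite ?muln1.
Qed.

(** Two out-neighbours of p are equal, or joined by an arc in one of the two directions. *)
Lemma sum_out_sq : \sum_p out p ^ 2 = \sum_p out p + trans + trans.
Proof.
rewrite {1}/trans -!big_split /=; apply: eq_bigr => p _.
rewrite [X in _ = _ + X]exchange_big /=.
rewrite -mulnn {1 3}/out big_distrl /= -big_split /= -big_split /=.
apply: eq_bigr => q _.
rewrite /out big_distrr /=.
have -> : a p q + \sum_r a p q * a q r * a p r + \sum_r a p r * a r q * a p q =
   \sum_r (a p q * (r == q) + a p q * a q r * a p r + a p r * a r q * a p q).
  rewrite !big_split /=; congr (_ + _ + _).
  by rewrite (bigD1 q) //= eqxx muln1 big1 ?addn0 // => r /negPf->; rewrite muln0.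
apply: eq_bigr => r _ /=; have [->|rq] := eqVneq r q.
  by rewrite a_irr !muln0; case: (a p q).
by rewrite (a_tour rq); case: (a p q); case: (a q r); case: (a p r).
Qed.
End Tournament.

Section TournamentBound.
Local Open Scope nat_scope.
Variables (V : finType) (a : rel V).
Hypothesis a_irr : irreflexive a.
Hypothesis a_tour : forall p q, p != q -> a p q = ~~ a q p.

Lemma tournament_cyclic_le :
  8 * (\sum_p \sum_q \sum_r a p q * a q r * a r p) <= Delta24 #|V|.
Proof.
pose b p q := a q p.
have b_irr : irreflexive b by move=> p; apply: a_irr.
have b_tour p q : p != q -> b p q = ~~ b q p.
  by move=> pq; rewrite /b a_tour // eq_sym.
set n := #|V|; set cyc := (X in 8 * X).
pose out p : nat := \sum_q a p q; pose inn p : nat := \sum_q a q p.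
pose trans := \sum_p \sum_q \sum_r a p q * a q r * a p r.
have e1 : \sum_q inn q * out q = cyc + trans by apply: sum_inn_out.
have e2 : \sum_p out p ^ 2 = \sum_p out p + trans + trans by apply: sum_out_sq.
have e3 : \sum_p inn p ^ 2 = \sum_p inn p + trans + trans.
  have -> : trans = \sum_p \sum_q \sum_r b p q * b q r * b p r.
    rewrite /trans; under eq_bigr do rewrite exchange_big.
    rewrite exchange_big /=; under eq_bigr do rewrite exchange_big /=.
    by do 3 (apply: eq_bigr => ? _); rewrite /b [X in X * _]mulnC.
  exact: (sum_out_sq b_irr b_tour).
have oi p : out p + inn p = n - 1 by apply: out_inn.
(* The degrees at a vertex sum to n - 1. For even n they therefore differ, which improves the bound
   (n - 1)^2 by one to n(n - 2). *)
pose M := if odd n then (n - 1) ^ 2 else n * (n - 2).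
have io p : 4 * (inn p * out p) <= M.
  rewrite /M; move: (oi p); move: (inn p) (out p) => i o e.
  case: ifP => on; first by rewrite -e -mulnn; case: (leqP i o) => h; nia.
  have [n0|n0] := posnP n; first by nia.
  have io : i != o by apply/eqP => E; move: on; rewrite -(prednK n0) -subn1 -e E; lia.
  have -> : n * (n - 2) = (n - 1) * (n - 1) - 1 by nia.
  rewrite -e; case: (ltngtP i o) io => // lt_io _.
    have [k ->] : exists k, o = i + k.+1 by exists (o - i.+1); lia.
    nia.
  have [k ->] : exists k, i = o + k.+1 by exists (i - o.+1); lia.
  nia.
have s1 : 4 * \sum_p inn p * out p <= n * M.
  by rewrite big_distrr /=; apply: (leq_trans (leq_sum _ _) _) => [p _|];
     [exact: io|rewrite sum_nat_const].
have s2 : \sum_p out p + \sum_p inn p = n * (n - 1).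
  by rewrite -big_split /= (eq_bigr (fun=> n - 1)) ?sum_nat_const // => p _.
have s3 : \sum_p out p ^ 2 + \sum_p inn p ^ 2 + 2 * \sum_p inn p * out p
          = n * (n - 1) ^ 2.
  rewrite big_distrr -!big_split /= (eq_bigr (fun=> (n - 1) ^ 2)) ?sum_nat_const //.
  by move=> p _; rewrite -(oi p); nia.
(* Eliminating [trans] gives 4 cyc = n(n - 1) + 6 S - n(n - 1)^2, where S is the sum of in-degree
   times out-degree. *)
have key : 8 * cyc + 2 * (n * (n - 1) ^ 2) <= 3 * (n * M) + 2 * (n * (n - 1)).
  by move: e1 e2 e3 s1 s2 s3; clear; lia.
rewrite /Delta24; move: key; rewrite /M; case: ifP => on.
  case: (n) on => // m _; rewrite subn1 /= => key; nia.
case: (n) on => [|[|m]] // _ ; first by lia.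
have -> : m.+2 - 2 = m by lia.
have -> : m.+2 - 1 = m.+1 by lia.
nia.
Qed.
End TournamentBound.

(** * Bounding a system by deleting triangles *)

Section DeletionBound.
Local Open Scope nat_scope.
Variables (V : finType) (E x : V -> V -> V -> bool).
Hypothesis E_rot : forall p q r, E p q r = E q r p.
Hypothesis E_irr : forall p r, ~~ E p p r.
Hypothesis x_hit : forall p q r s, E p q r -> E q p s ->
  [|| x p q r, x q r p, x r p q, x q p s, x p s q | x s q p].

(** The surviving triangles [F] orient their sides consistently, and ordering the remaining pairs by
    rank completes a tournament. The factor 24 is 8 times 3: a triangle may be deleted through any
    of its three rotations. *)
Lemma deletion_bound :
  8 * (\sum_p \sum_q \sum_r E p q r) <=
  Delta24 #|V| + 24 * \sum_p \sum_q \sum_r x p q r.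
Proof.
pose F p q r := E p q r && ~~ [|| x p q r, x q r p | x r p q].
have F_rot p q r : F p q r = F q r p.
  by rewrite /F E_rot; case: (x p q r); rewrite ?orbT ?orbF.
pose arc p q := [exists r, F p q r].
have arc_anti p q : arc p q -> ~~ arc q p.
  move=> /existsP[r /andP[Er xr]]; apply/existsP => -[s /andP[Es xs]].
  move: xr xs (x_hit Er Es); rewrite !negb_or.
  by move=> /and3P[/negPf-> /negPf-> /negPf->] /and3P[/negPf-> /negPf-> /negPf->].
have arc_irr p : ~~ arc p p.
  by apply/existsP => -[r /andP[]]; rewrite (negPf (E_irr p r)).
pose a p q := arc p q || [&& p != q, ~~ arc q p & enum_rank p < enum_rank q].
have a_irr : irreflexive a by move=> p; rewrite /a eqxx (negPf (arc_irr p)).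
have a_tour p q : p != q -> a p q = ~~ a q p.
  move=> pq; rewrite /a (eq_sym q) pq /=.
  have : enum_rank p != enum_rank q by rewrite (inj_eq enum_rank_inj).
  have := @arc_anti p q; have := @arc_anti q p.
  case: (arc p q); case: (arc q p) => //=; first by move=> /(_ isT).
  move=> _ _.
  by rewrite neq_ltn; case: ltngtP.
have aF p q r : F p q r <= a p q * a q r * a r p.
  have aE u v w : F u v w -> a u v by move=> f; apply/orP; left; apply/existsP; exists w.
  case: (boolP (F p q r)) => // f; rewrite (aE _ _ _ f).
  by rewrite (aE q r p) -1?F_rot // (aE r p q) // F_rot.
have FE p q r : E p q r <= F p q r + x p q r + x q r p + x r p q.
  by rewrite /F; case: (E p q r); case: (x p q r); case: (x q r p); case: (x r p q).
have {}FE : \sum_p \sum_q \sum_r E p q r <=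
   \sum_p \sum_q \sum_r a p q * a q r * a r p + \sum_p \sum_q \sum_r x p q r
   + \sum_p \sum_q \sum_r x q r p + \sum_p \sum_q \sum_r x r p q.
  rewrite -!big_split /=; apply: leq_sum => p _.
  rewrite -!big_split /=; apply: leq_sum => q _.
  rewrite -!big_split /=; apply: leq_sum => r _.
  by apply: leq_trans (FE p q r) _; rewrite !leq_add2r aF.
have r1 : \sum_p \sum_q \sum_r x q r p = \sum_p \sum_q \sum_r x p q r.
  rewrite exchange_big /=; apply: eq_bigr => p _; exact: exchange_big.
have r2 : \sum_p \sum_q \sum_r x r p q = \sum_p \sum_q \sum_r x p q r.
  rewrite -r1; under eq_bigr do rewrite exchange_big /=.
  by rewrite exchange_big.
have := tournament_cyclic_le a_irr a_tour.
by move: FE; rewrite r1 r2; lia.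
Qed.
End DeletionBound.

(** * Systems without two triangles touching in a common vertex *)

(* The alternating walks of two fixed-point-free involutions f and g split    *)
(* each component into two orbits of g \o f, exchanged by f and by g.         *)
Lemma involutions_coloring (W : finType) (f g : W -> W) :
  involutive f -> involutive g -> (forall w, f w != w) -> (forall w, g w != w) ->
  exists c : W -> bool, forall w, c (f w) = ~~ c w /\ c (g w) = ~~ c w.
Proof.
move=> fK gK f_fix g_fix; pose h w := g (f w).
have h_inj : injective h by apply: inj_comp; apply: inv_inj.
have h_fix i w : iter i h w != f w.
  elim/ltn_ind: i w => -[|[|i]] IH w; first by rewrite eq_sym.
    exact: g_fix.
  (* The induction drops by two: if f w is the image of w under h^(i+2), then f (h w) is the image
     of h w under h^i. *)
  apply/eqP => e; case/eqP: (IH i (ltnW (ltnSn _)) (h w)).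
  by apply: h_inj; rewrite -iterS -iterSr e /h fK gK.
have root_h w : froot h (h w) = froot h w.
  by apply/esym/eqP; rewrite root_connect ?fconnect1 //; apply: fconnect_sym.
have root_f w : froot h w != froot h (f w).
  rewrite root_connect; last exact: fconnect_sym.
  by apply/negP => /iter_findex e; move: (h_fix (findex h w (f w)) w); rewrite e eqxx.
exists (fun w => enum_rank (froot h w) < enum_rank (froot h (f w)))%N => w.
have : enum_rank (froot h w) != enum_rank (froot h (f w)).
  by rewrite (inj_eq enum_rank_inj).
have -> : froot h (g w) = froot h (f w) by rewrite -(root_h (f w)) /h fK.
have -> : froot h (f (g w)) = froot h w by rewrite -root_h /h fK gK.
by rewrite fK neq_ltn; case: ltngtP.
Qed.

(** On two copies of [V], each matching extends to a fixed-point-free involution: unmatched vertices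
    are swapped with their copies. *)
Lemma matchings_coloring (V : finType) (M N : rel V) :
  symmetric M -> symmetric N -> irreflexive M -> irreflexive N ->
  (forall x y z, M x y -> M x z -> y = z) ->
  (forall x y z, N x y -> N x z -> y = z) ->
  exists c : V -> bool, forall x y, M x y || N x y -> c x != c y.
Proof.
move=> Ms Ns Mi Ni Mf Nf.
pose inv (A : rel V) (w : V * bool) :=
  if [pick u | A w.1 u] is Some u then (u, w.2) else (w.1, ~~ w.2).
have invK (A : rel V) : symmetric A -> (forall x y z, A x y -> A x z -> y = z) ->
    involutive (inv A).
  move=> As Af [v b]; rewrite /inv /=.
  case: (pickP (A v)) => [u Avu|nu] /=; last first.
    by case: (pickP (A v)) => [u|_ /=]; rewrite ?nu ?negbK.
  have Auv : A u v by rewrite As.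
  by case: pickP => /= [u' Au'|/(_ v)/negP//]; rewrite (Af _ _ _ Au' Auv).
have inv_fix (A : rel V) w : irreflexive A -> inv A w != w.
  move=> Ai; rewrite /inv; case: w => v b /=; case: pickP => [u Au|_].
    by apply/eqP => -[uv]; rewrite uv Ai in Au.
  by apply/eqP => -[]; case: b.
have invE (A : rel V) x y b : (forall x y z, A x y -> A x z -> y = z) ->
    A x y -> inv A (x, b) = (y, b).
  by move=> Af Axy; rewrite /inv; case: pickP => /= [u /(Af _ _ _ Axy)->|/(_ y)/negP].
have [c cP] := involutions_coloring (invK M Ms Mf) (invK N Ns Nf)
  (fun w => inv_fix M w Mi) (fun w => inv_fix N w Ni).
exists (fun v => c (v, true)) => x y; have [cM cN] := cP (x, true).
case/orP => [/(invE M x y true Mf) e|/(invE N x y true Nf) e].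
  by rewrite -e cM; case: (c _).
by rewrite -e cN; case: (c _).
Qed.

(* o p q r reads "pqr is counterclockwise".  The field o_cone says that the   *)
(* cone xpy around s cannot lie to the left of pq with s to the right; o_strip *)
(* says that the strip bounded by pq and the rays pv and qw (both on the left *)
(* of pq) cannot be continued on both sides of pq.                            *)
Record orientation (V : finType) (o : V -> V -> V -> bool) : Prop := {
  o_rot : forall p q r, o p q r = o q r p;
  o_irr : forall p r, o p p r = false;
  o_swap : forall p q r, p != q -> p != r -> q != r -> o p q r = ~~ o p r q;
  o_cone : forall p q x y s,
    o p q x -> o p q y -> o p x y -> o p x s -> o p s y -> ~~ o p s q;
  o_strip : forall p q v w r s, o p q v -> o p q w ->
    o p q r -> (r == v) || o p v r -> (r == w) || o q r w ->
    o p s q -> o p v s -> ~~ o q s w }.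

(** * The graph of double edges *)

Section Crossing.
Local Open Scope nat_scope.
Variables (V : finType) (o E : V -> V -> V -> bool).
Hypothesis o_or : orientation o.
Hypothesis E_rot : forall p q r, E p q r = E q r p.
Hypothesis E_o : forall p q r, E p q r -> o p q r.

(** For pab counterclockwise: the ray pc lies in the closed angle from pa to pb. Two angles at p
    share a ray exactly when one contains the initial ray of the other, so [E_meet] expresses the
    avoidance of S1. *)
Definition between p a b c := [|| c == a, c == b | o p a c && o p c b].

Hypothesis E_meet : forall p a b c d, E p a b -> E p c d ->
  between p a b c || between p c d a.

Definition double p q := [exists r, E p q r] && [exists r, E p r q].

Lemma o_neq p q r : o p q r -> [/\ p != q, p != r & q != r].
Proof.
move=> h; split; apply/eqP => e; move: h; rewrite e ?(o_irr o_or) //.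
  by rewrite -(o_rot o_or) (o_irr o_or).
by rewrite (o_rot o_or) (o_irr o_or).
Qed.

Lemma o_anti p q r : o p q r -> o p r q = false.
Proof.
by move=> h; have [pq pr qr] := o_neq h; apply/negbTE; rewrite -(o_swap o_or).
Qed.

Lemma o_flip p q r : p != q -> p != r -> q != r -> o q p r = ~~ o p q r.
Proof.
by move=> pq pr qr; rewrite (o_rot o_or) (o_swap o_or pq pr qr) negbK.
Qed.

Lemma double_sym p q : double p q = double q p.
Proof.
rewrite /double andbC; congr (_ && _); apply/eq_existsb => r.
  by rewrite E_rot E_rot.
by rewrite E_rot.
Qed.

Lemma doubleP p q : double p q -> (exists r, E p q r) /\ (exists r, E p r q).
Proof. by move=> /andP[/existsP ? /existsP]. Qed.

Lemma doubleI p q r s : E p q r -> E p s q -> double p q.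
Proof. by move=> h h'; apply/andP; split; apply/existsP; [exists r|exists s]. Qed.

Lemma double_neq p q : double p q -> p != q.
Proof. by move=> /doubleP[[r /E_o/o_neq[]]]. Qed.

(* Were x and y on the same side of the line pq, some triangle on the other   *)
(* side of pq would meet the triangle pxy at p only.                          *)
Lemma double_cross p q x y : double p q -> E p x y -> x != q -> y != q ->
  o p q x = ~~ o p q y.
Proof.
move=> /doubleP[[t tE] [s sE]] xyE xq yq.
have xyo := E_o xyE; have so := E_o sE; have to := E_o tE.
have [px py xy] := o_neq xyo; have [pq pt qt] := o_neq to.
have [ps _ sq] := o_neq so.
case qx: (o p q x); case qy: (o p q y) => //; last first.
  have xqo : o p x q by rewrite (o_swap o_or) // qx.
  have yqo : o p y q by rewrite (o_swap o_or) // qy.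
  move: (E_meet xyE tE); rewrite /between.
  rewrite (eq_sym q x) (eq_sym q y) (negPf xq) (negPf yq) qx qy andbF /= orbF.
  by move=> /eqP xt; rewrite -xt qx in to.
move: (E_meet xyE sE); rewrite /between (negPf xq) (o_anti qx) andbF !orbF /=.
case/orP=> [/or3P[/eqP e|/eqP e|/andP[xs sy]]|/eqP e].
- by rewrite e (o_anti qx) in so.
- by rewrite e (o_anti qy) in so.
- by move: (o_cone o_or qx qy xyo xs sy); rewrite so.
- by rewrite -e (o_anti qx) in so.
Qed.

(** Otherwise [double_cross] puts q to the left of pq' and q' to the left of pq. *)
Lemma double_head_uniq p q q' r :
  double p q -> double p q' -> E p r q -> E p r q' -> q = q'.
Proof.
move=> dq dq' e e'; apply/eqP; apply: contraT => qq'.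
have [_ pq rq] := o_neq (E_o e); have [_ pq' rq'] := o_neq (E_o e').
have := double_cross dq' e rq' qq'; rewrite (o_anti (E_o e')) => /esym/negbFE h.
have := double_cross dq e' rq; rewrite eq_sym qq' => /(_ isT).
by rewrite (o_anti (E_o e)) (o_anti h).
Qed.

Lemma double_tail_uniq p q q' r :
  double p q -> double p q' -> E p q r -> E p q' r -> q = q'.
Proof.
move=> dq dq' e e'; apply/eqP; apply: contraT => qq'.
have [pq _ qr] := o_neq (E_o e); have [pq' _ qr'] := o_neq (E_o e').
have := double_cross dq' e qq'; rewrite eq_sym qr' (E_o e') => /(_ isT) h.
have := double_cross dq e'; rewrite eq_sym qq' eq_sym qr (E_o e) => /(_ isT isT).
by rewrite (o_swap o_or) // h.
Qed.

(** If q' and p' were both to the left of pq, triangles on both sides of pq would force the lines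
    pq' and qp' to converge on both sides, against [o_strip]. *)
Lemma double_zigzag p q q' p' : double p q -> double p q' -> q' != q ->
  double q p' -> p' != p -> o p q q' = ~~ o p q p'.
Proof.
suff both a b b' a' : double a b -> double a b' -> b' != b ->
    double b a' -> a' != a -> o a b b' -> o a b a' -> False.
  move=> dq dq' q'q dp' p'p.
  have [[pq pq'] qp'] := (double_neq dq, double_neq dq', double_neq dp').
  have p'q := qp'; rewrite eq_sym in p'q.
  case h: (o p q q'); case h': (o p q p') => //; first by case: (both p q q' p').
  have qp : q != p by rewrite eq_sym.
  case: (both q p p' q') => //; rewrite 1?double_sym //.
    by rewrite o_flip // 1?eq_sym // h'.
  by rewrite o_flip // 1?eq_sym // h.
move=> db db' b'b da' a'a ob' oa'.
have [[r rE] [s sE]] := doubleP db.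
have [ro so] := (E_o rE, E_o sE).
have [ab ar br] := o_neq ro; have [as_ _ sb] := o_neq so.
have [_ aa' ba'] := o_neq oa'; have [_ ab' bb'] := o_neq ob'.
have sb' : s != b' by apply: contraTneq so => ->; rewrite (o_anti ob').
have sa' : s != a' by apply: contraTneq so => ->; rewrite (o_anti oa').
have oa2 : o b a' a by rewrite -(o_rot o_or).
have h1 : (r == b') || o a b' r.
  case: eqVneq => //= rb'; have := double_cross db' rE bb' rb'.
  by rewrite (o_anti ob') => /esym/negbFE.
have h2 : (r == a') || o b r a'.
  case: eqVneq => //= ra'.
  have rE' : E b r a by rewrite -E_rot.
  have := double_cross da' rE' ra'; rewrite eq_sym a'a => /(_ isT).
  by rewrite oa2 /= => h; rewrite (o_swap o_or) ?h.
have h3 : o a b' s.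
  by have := double_cross db' sE sb' bb'; rewrite (o_anti ob').
have h4 : o b s a'.
  have sE' : E b a s by rewrite E_rot.
  have := double_cross da' sE'; rewrite eq_sym a'a => /(_ isT sa').
  rewrite oa2 => /esym h.
  by rewrite (o_swap o_or) ?h // eq_sym.
by move: (o_strip o_or ob' oa' ro h1 h2 so h3); rewrite h4.
Qed.

Definition doubles p := [set q | double p q].

(* The exceptional vertices of the S1 bound: the centres of the stars.        *)
Definition cyclic p := [exists q, double p q] &&
  [forall (q | double p q), exists x, double p x && E p x q].

Let link p := [set e : V * V | E p e.1 e.2 && (double p e.1 || double p e.2)].

(** Charge a triangle of the link to its non-double end, or to its head if both ends are double.
    Head and tail uniqueness make this injective. *)
Lemma card_link p (S : {set V}) :
  (forall x y, E p x y -> double p x -> double p y -> y \in S) ->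
  (forall x y, E p x y -> ~~ double p x -> x \in S) ->
  (forall x y, E p x y -> ~~ double p y -> y \in S) ->
  #|link p| <= #|S|.
Proof.
move=> S1 S2 S3.
pose f (e : V * V) := if double p e.2 && ~~ double p e.1 then e.1 else e.2.
have f_inj : {in link p &, injective f}.
  move=> [x y] [x' y']; rewrite !inE /f /= => /andP[e d] /andP[e' d'] h.
  case dy: (double p y) d h => d h; case dx: (double p x) d h => //= d h;
  case dy': (double p y') d' h => d' h; case dx': (double p x') d' h => //= d' h;
  subst; try congruence.
  all: try (have := doubleI e e'; congruence).
  all: try (have := doubleI e' e; congruence).
  all: try by congr (_, _); apply: double_head_uniq e e'.
  all: try by congr (_, _); apply: double_tail_uniq e e'.
rewrite -(card_in_imset f_inj); apply/subset_leq_card/fintype.subsetP => z.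
move=> /imsetP[[x y]]; rewrite inE /f /= => /andP[e].
case: (boolP (double p y)) => dy; case: (boolP (double p x)) => //= dx _ ->.
- exact: S1 e dx dy.
- exact: S2 e dx.
- exact: S3 e dy.
Qed.

(* At a double neighbour q0 of p, every triangle of p avoiding q0 crosses the *)
(* line p q0, so opposite choices on its two sides delete nearly disjoint     *)
(* sets of triangles.                                                         *)
Lemma local_deletion p : exists X : V -> V -> bool,
  (forall q, double p q ->
     (forall x, E p x q -> X x q) \/ (forall y, E p q y -> X q y)) /\
  \sum_q \sum_r X q r <= if cyclic p then #|V|./2 else (#|V| - 2)./2.
Proof.
have [[q0 dq0]|nod] := pselect (exists q, double p q); last first.
  exists (fun _ _ => false); split=> [q dq|]; first by case: nod; exists q.
  by rewrite big1 // => q _; rewrite big1.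
(* For non-cyclic p, this choice makes [D1] and [D2] below disjoint and lets [card_link] omit q0
   from the count. *)
have {q0 dq0} [q0 [dq0 q0P]] : exists q0, double p q0 /\
    (~~ cyclic p -> forall x, double p x -> ~~ E p x q0).
  case: (boolP (cyclic p)) => cp; first by exists q0.
  move: cp; rewrite negb_and => /orP[/existsP[]|]; first by exists q0.
  rewrite negb_forall => /existsP[q]; rewrite negb_imply => /andP[dq nq].
  exists q; split=> // _ x dx; apply: contra nq => e; apply/existsP; exists x.
  by rewrite dx.
pose L q := o p q0 q.
(* [D1] deletes the triangles with head q for double q left of p q0 and those with tail q for the
   other double q; [D2] makes the opposite choices. Either set settles all double edges at p, so the
   smaller one is kept. *)
pose D1 := [set e : V * V | E p e.1 e.2 &&
  (double p e.2 && L e.2 || double p e.1 && ~~ L e.1)].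
pose D2 := [set e : V * V | E p e.1 e.2 &&
  (double p e.2 && ~~ L e.2 || double p e.1 && L e.1)].
have q0q0 : o p q0 q0 = false by rewrite (o_rot o_or) (o_irr o_or).
have D12U : D1 :|: D2 = link p.
  apply/setP => -[x y]; rewrite !inE /=; case: (E p x y) => //=.
  by case: (double p y); case: (L y); case: (double p x); case: (L x).
have D12I e : e \in D1 :&: D2 -> [/\ e.2 = q0, double p e.1 & E p e.1 q0].
  case: e => x y; rewrite !inE /= => /andP[/andP[e d1] /andP[_ d2]].
  have [yq0|yq0] := eqVneq y q0.
    by rewrite yq0 in e d1 d2 *; move: d1 d2; rewrite /L q0q0 andbF /= => /andP[].
  have [xq0|xq0] := eqVneq x q0.
    by move: e d1 d2; rewrite xq0 /L q0q0 => /E_o -> _; rewrite /= !andbF.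
  move: d1 d2; rewrite /L (double_cross dq0 e xq0 yq0).
  by case: (double p y); case: (double p x); case: (o p q0 y).
have cI : #|D1 :&: D2| <= cyclic p.
  case: (boolP (cyclic p)) => cp.
    rewrite -[nat_of_bool true](cards1 q0).
    have [->|[[x y] xyI]] := set_0Vmem (D1 :&: D2); first by rewrite cards0.
    have [/= _ dx ex] := D12I _ xyI.
    rewrite cards1 -(cards1 (x, q0)); apply/subset_leq_card/fintype.subsetP => -[x' y'].
    move=> /D12I[/= -> dx' ex']; rewrite inE.
    by rewrite (double_tail_uniq dx dx' ex ex').
  rewrite leqn0 cards_eq0; apply/eqP/setP => e; rewrite [RHS]inE; apply/negP.
  by move=> /D12I[_ d]; apply/negP; exact: q0P.
have cU : #|D1 :|: D2| <= if cyclic p then #|V| - 1 else #|V| - 2.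
  rewrite D12U; case: (boolP (cyclic p)) => cp.
    apply: leq_trans (_ : #|[set~ p]| <= _); last by rewrite cardsC1 subn1.
    by apply: card_link => x y /E_o/o_neq[px py _] *; rewrite !inE eq_sym.
  apply: leq_trans (_ : #|[set~ p] :\ q0| <= _); last first.
    have := cardsD1 q0 [set~ p]; rewrite cardsC1 !inE eq_sym (double_neq dq0).
    by lia.
  apply: card_link => x y e; have [px py _] := o_neq (E_o e).
  - move=> dx dy; rewrite !inE eq_sym [y == p]eq_sym py andbT.
    by apply: contraTneq e => <-; apply: q0P.
  - by move=> dx; rewrite !inE [x == p]eq_sym px andbT; apply: contraNneq dx => ->.
  - by move=> dy; rewrite !inE [y == p]eq_sym py andbT; apply: contraNneq dy => ->.
have sumD (D : {set V * V}) : \sum_q \sum_r ((q, r) \in D) = #|D|.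
  rewrite pair_bigA /= -sum1_card [RHS]big_mkcond /=.
  by apply: eq_bigr => -[q r] _; case: ifP.
have D1P q : double p q ->
    (forall x, E p x q -> (x, q) \in D1) \/ (forall y, E p q y -> (q, y) \in D1).
  move=> dq; case Lq: (L q); [left=> x e|right=> y e]; rewrite inE /= e dq Lq //=.
  by rewrite orbT.
have D2P q : double p q ->
    (forall x, E p x q -> (x, q) \in D2) \/ (forall y, E p q y -> (q, y) \in D2).
  move=> dq; case Lq: (L q); [right=> x e|left=> y e]; rewrite inE /= e dq Lq //=.
  by rewrite orbT.
have V0 : 0 < #|V| by apply/card_gt0P; exists p.
have half_sum k : #|D1| + #|D2| <= k -> exists X : V -> V -> bool,
  (forall q, double p q ->
     (forall x, E p x q -> X x q) \/ (forall y, E p q y -> X q y)) /\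
  \sum_q \sum_r X q r <= k./2.
  move=> Dk; have [c|/ltnW c] := leqP #|D1| #|D2|.
    exists (fun q r => (q, r) \in D1); rewrite sumD geq_half_double -addnn.
    by split=> //; apply: leq_trans Dk; rewrite leq_add2l.
  exists (fun q r => (q, r) \in D2); rewrite sumD geq_half_double -addnn.
  by split=> //; apply: leq_trans Dk; rewrite leq_add2r.
have := leq_add cU cI; rewrite cardsUI; case: (cyclic p) => /= h; apply: half_sum.
  by rewrite subnK // in h.
by rewrite addn0 in h.
Qed.

(** The map from a double neighbour to its double predecessor is injective on a finite set, hence
    onto, so successors exist too. *)
Lemma cyclic_sides p q : cyclic p -> double p q -> exists x y,
  [/\ double p x, double p y, E p x q & E p q y].
Proof.
move=> /andP[_ /forallP cp] dq.
pose f q := odflt q [pick x | double p x && E p x q].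
have fP r : double p r -> double p (f r) /\ E p (f r) r.
  move=> dr; rewrite /f; case: pickP => [x /andP[] //|np].
  by have := cp r; rewrite dr => /existsP[x]; rewrite np.
have f_inj : {in doubles p &, injective f}.
  move=> r r'; rewrite !inE => dr dr' e; have [_ er] := fP r dr.
  have [_ er'] := fP r' dr'; rewrite -e in er'.
  exact: double_head_uniq er er'.
have fD : f @: doubles p = doubles p.
  apply/eqP; rewrite eqEcard (card_in_imset f_inj) leqnn andbT.
  by apply/fintype.subsetP => _ /imsetP[r rD ->]; rewrite !inE in rD *; case: (fP r rD).
have : q \in f @: doubles p by rewrite fD inE.
move=> /imsetP[y]; rewrite inE => dy qy; have [dx ex] := fP q dq.
have [_ ey] := fP y dy; rewrite -qy in ey.
by exists (f q), y; split.
Qed.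

Lemma cyclic_card p : cyclic p -> 3 <= #|doubles p|.
Proof.
move=> cp; have /andP[/existsP[q dq] _] := cp.
have [x [y [dx dy ex ey]]] := cyclic_sides cp dq.
have [_ _ xq] := o_neq (E_o ex); have [_ _ qy] := o_neq (E_o ey).
have xy : x != y.
  by apply/eqP => e; move: (E_o ex); rewrite e (o_anti (E_o ey)).
have u : uniq [:: x; q; y] by rewrite /= !inE negb_or xq xy qy.
rewrite -[3]/(size [:: x; q; y]) -(card_uniqP u).
apply/subset_leq_card/fintype.subsetP => z.
by rewrite !inE => /or3P[] /eqP->.
Qed.

(** By [double_zigzag], another double neighbour of q would lie opposite both the predecessor and
    the successor of q, which are on different sides of pq. *)
Lemma cyclic_leaf p q p' : cyclic p -> double p q -> double q p' -> p' = p.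
Proof.
move=> cp dq dp'; apply/eqP; apply: contraT => p'p.
have [x [y [dx dy ex ey]]] := cyclic_sides cp dq.
have [_ _ xq] := o_neq (E_o ex); have [_ _ qy] := o_neq (E_o ey).
have := double_zigzag dq dx xq dp' p'p; rewrite (o_anti (E_o ex)).
rewrite eq_sym in qy; have := double_zigzag dq dy qy dp' p'p.
by rewrite (E_o ey) => <-.
Qed.

(** Split the edges between vertices of degree at least 2 by the side on which the path continues.
    The zigzag makes this side independent of the direction of travel and each class a matching;
    leaves are coloured afterwards. *)
Lemma double_coloring : exists c : V -> bool, forall p q, double p q -> c p != c q.
Proof.
pose core p := 1 < #|doubles p|.
have coreP p q : core p -> exists q', double p q' /\ q' != q.
  move=> cp; have : 0 < #|doubles p :\ q|.
    by move: cp; rewrite /core (cardsD1 q); case: (q \in _); lia.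
  by move=> /card_gt0P[q']; rewrite !inE => /andP[? ?]; exists q'.
pose M b p q := [&& double p q, core p, core q &
  [exists q', [&& double p q', q' != q & o p q q' == b]]].
have M_sym b : symmetric (M b).
  suff imp p q : M b p q -> M b q p by move=> p q; apply/idP/idP; apply: imp.
  move=> /and4P[dq cp cq /existsP[q' /and3P[dq' q'q /eqP ob]]].
  apply/and4P; split=> //; first by rewrite double_sym.
  have [p' [dp' p'p]] := coreP q p cq; apply/existsP; exists p'; rewrite dp' p'p /=.
  rewrite o_flip ?(double_neq dq) ?(double_neq dp') //; last by rewrite eq_sym.
  by rewrite -ob (double_zigzag dq dq' q'q dp' p'p).
have M_irr b : irreflexive (M b).
  by move=> p; apply/negP => /and4P[/double_neq]; rewrite eqxx.
have M_fun b p q q' : M b p q -> M b p q' -> q = q'.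
  move=> Mq Mq'; apply/eqP; apply: contraT => qq'.
  wlog ob : q q' Mq Mq' qq' / o p q q' = b.
    move=> W; have [|ob] := eqVneq (o p q q') b; first exact: W.
    have [/and4P[dq _ _ _] /and4P[dq' _ _ _]] := (Mq, Mq').
    apply: (W q' q) => //; first by rewrite eq_sym.
    rewrite (o_swap o_or) ?(double_neq dq) ?(double_neq dq') //; last by rewrite eq_sym.
    by move: ob; case: b {W Mq Mq'}; case: (o p q q').
  have /and4P[dq _ _ _] := Mq.
  have /and4P[dq' _ cq' /existsP[r /and3P[dr rq' /eqP or]]] := Mq'.
  (* Both r and q lie opposite p' across p q', hence on the same side of it, so q is on side b of p
     q', while q' is on side b of pq. *)
  have [p' [dp' p'p]] := coreP q' p cq'.
  have := double_zigzag dq' dr rq' dp' p'p.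
  rewrite or -(double_zigzag dq' dq qq' dp' p'p) -ob.
  rewrite (o_swap o_or) ?(double_neq dq) ?(double_neq dq') //.
  by case: (o p q' q).
have [c0 c0P] := matchings_coloring (M_sym true) (M_sym false) (M_irr true)
  (M_irr false) (@M_fun true) (@M_fun false).
have leaf p q q' : ~~ core p -> double p q -> double p q' -> q = q'.
  rewrite -leqNgt => /card_le1_eqP cp dq dq'.
  by apply: cp; rewrite inE.
pose c p := if core p then c0 p else if [pick u | double p u] is Some u then
  (if core u then ~~ c0 u else enum_rank p < enum_rank u) else true.
have c_leaf p q : ~~ core p -> double p q ->
    c p = if core q then ~~ c0 q else enum_rank p < enum_rank q.
  move=> cp dq; rewrite /c (negPf cp); case: pickP => [u du|/(_ q)/negP//].
  by rewrite (leaf p q u cp dq du).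
exists c => p q dq; have dp : double q p by rewrite double_sym.
case: (boolP (core p)) => cp; case: (boolP (core q)) => cq.
- rewrite /c cp cq; apply: c0P; have [q' [dq' q'q]] := coreP p q cp.
  have Mo : M (o p q q') p q.
    by apply/and4P; split=> //; apply/existsP; exists q'; rewrite dq' q'q eqxx.
  by move: Mo; case: (o p q q') => ->; rewrite ?orbT.
- by rewrite (c_leaf q p cq dp) cp /c cp; case: (c0 p).
- by rewrite (c_leaf p q cp dq) cq /c cq; case: (c0 q).
- rewrite (c_leaf p q cp dq) (c_leaf q p cq dp) (negPf cp) (negPf cq).
  have : enum_rank p != enum_rank q by rewrite (inj_eq enum_rank_inj) double_neq.
  by rewrite neq_ltn; case: ltngtP.
Qed.

Lemma meeting_deletion : exists x : V -> V -> V -> bool,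
  \sum_p \sum_q \sum_r x p q r <= #|V|./2 * (#|V| - 2)./2 /\
  forall p q r s, E p q r -> E q p s ->
    [|| x p q r, x q r p, x r p q, x q p s, x p s q | x s q p].
Proof.
have [X XP] := choice local_deletion.
have [c cP] := double_coloring.
pose C := [set p | cyclic p].
pose N := [set v | [exists u, cyclic u && double u v]].
have leafN u v p' : cyclic u -> double u v -> double v p' -> p' = u.
  by move=> cu dv; apply: cyclic_leaf.
have NC v : v \in N -> v \notin C.
  rewrite !inE => /existsP[u /andP[cu du]]; apply/negP => cv.
  have dvu : double v u by rewrite double_sym.
  have [a [b [da db ea eb]]] := cyclic_sides cv dvu.
  by move: (E_o ea); rewrite (leafN u v a cu du da) => /o_neq[_ _]; rewrite eqxx.
have card_NC : 3 * #|C| <= #|N|.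
  rewrite mulnC -sum_nat_const.
  apply: (@leq_trans (\sum_(u in C) \sum_v double u v)).
    apply: leq_sum => u; rewrite inE => /cyclic_card/leq_trans; apply.
    rewrite -sum1_card big_mkcond /=; apply: leq_sum => v _; rewrite inE.
    by case: (double u v).
  rewrite exchange_big -sum1_card [X in _ <= X]big_mkcond /=; apply: leq_sum => v _.
  case: (boolP (v \in N)) => vN; last first.
    rewrite big1 // => u; rewrite inE => cu; apply/eqP; rewrite eqb0.
    by apply: contra vN => du; rewrite inE; apply/existsP; exists u; rewrite cu.
  move: vN; rewrite inE => /existsP[u /andP[cu du]].
  rewrite (bigD1 u) ?inE //= big1 ?addn0 ?leq_b1 // => u' /andP[_ u'u].
  apply/eqP; rewrite eqb0; apply: contra u'u => du'; apply/eqP.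
  by apply: leafN cu du _; rewrite double_sym.
pose W := ~: (C :|: N).
have cardW : 4 * #|C| + #|W| <= #|V|.
  rewrite -(cardsC (C :|: N)) -/W leq_add2r.
  rewrite cardsU (_ : C :&: N = finset.set0) ?cards0 ?subn0; first by lia.
  by apply/setP => v; rewrite [LHS]inE [RHS]inE andbC; apply/negP => /andP[/NC/negP].
pose B b := [set v in W | c v == b].
have cardB : #|B true| + #|B false| = #|W|.
  rewrite -(cardsID (B true) W); congr (_ + _); apply: eq_card => v; rewrite !inE.
    by rewrite andbA andbb.
  by case: (c v); rewrite ?andbF ?andbT //= ?eqxx; case: (_ || _).
have [b Bb] : exists b, #|B b| <= #|W|./2.
  have [h|h] := leqP #|B true| #|B false|.
    exists true; rewrite geq_half_double -addnn -cardB leq_add2l //.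
  by exists false; rewrite geq_half_double -addnn -cardB leq_add2r ltnW.
(* Every double edge has a responsible endpoint: a leaf of a star is joined only to its centre, and
   an edge inside [W] has both colours. *)
pose resp p := (p \in B b) || (p \in C).
exists (fun p q r => resp p && X p q r); split.
  have card4 : 0 < #|C| -> #|V|./2 <= 2 * (#|V| - 2)./2.
    by move=> C0; have : 4 <= #|V| by [lia]; move: #|V| => n n4; lia.
  set K := (#|V| - 2)./2 in card4 *.
  apply: (@leq_trans (\sum_(p in B b) K + \sum_(p in C) 2 * K)).
    rewrite [X in _ <= X + _]big_mkcond [X in _ <= _ + X]big_mkcond -big_split /=.
    apply: leq_sum => p _; have [_] := XP p; rewrite /resp [p \in C]inE => h.
    case: (boolP (cyclic p)) h => cp h; last first.
      by rewrite orbF addn0; case: (p \in B b) => //; rewrite big1 // => q _; rewrite big1.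
    rewrite orbT /=; apply: leq_trans h _.
    apply: leq_trans (leq_addl _ _); apply: card4.
    by apply/card_gt0P; exists p; rewrite inE.
  rewrite !sum_nat_const mulnA -mulnDl leq_mul2r; apply/orP; right.
  by move: cardW Bb; clear; lia.
move=> p q r s epr eqs; have psq : E p s q by rewrite -E_rot.
have dpq : double p q by apply: doubleI epr psq.
have dqp : double q p by rewrite double_sym.
have qrp : E q r p by rewrite -E_rot.
have [rp|nrp] := boolP (resp p).
  have [X1|X2] := (XP p).1 q dpq; first by rewrite (X1 s psq) !orbT.
  by rewrite (X2 r epr).
have [rq|nrq] := boolP (resp q).
  have [X1|X2] := (XP q).1 p dqp; first by rewrite (X1 r qrp) !orbT.
  by rewrite (X2 s eqs) !orbT.
have inW u v : double u v -> ~~ resp u -> ~~ resp v -> u \in W.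
  move=> duv; rewrite /resp !negb_or => /andP[_ uC] /andP[_ vC].
  rewrite finset.in_setC finset.in_setU negb_or uC /=; apply: contra vC.
  rewrite inE => /existsP[u' /andP[cu' du']].
  by rewrite (leafN _ _ _ cu' du' duv) inE.
have := cP p q dpq; have := nrp; have := nrq.
rewrite /resp !negb_or => /andP[qB _] /andP[pB _].
have pW := inW p q dpq nrp nrq; have qW := inW q p dqp nrq nrp.
move: qB pB; rewrite [q \in _]inE [p \in _]inE pW qW /=.
by case: (c p); case: (c q); case: (b).
Qed.

Lemma meeting_bound : 8 * (\sum_p \sum_q \sum_r E p q r) <=
  Delta24 #|V| + 24 * (#|V|./2 * (#|V| - 2)./2).
Proof.
have [x [cx hx]] := meeting_deletion.
apply: leq_trans (deletion_bound E_rot _ hx) _.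
  by move=> p r; apply/negP => /E_o/o_neq[]; rewrite eqxx.
by rewrite leq_add2l leq_mul2l cx.
Qed.
End Crossing.

(** * Pairwise meeting triangles and plane geometry *)

Section PairwiseMeeting.
Local Open Scope nat_scope.
Variables (V : finType) (o E : V -> V -> V -> bool).
Hypothesis o_or : orientation o.
Hypothesis E_rot : forall p q r, E p q r = E q r p.
Hypothesis E_o : forall p q r, E p q r -> o p q r.
Hypothesis E_opp : forall p q x y x' y', E p x y -> o p q x -> o p q y ->
  E q x' y' -> o q p x' -> o q p y' -> False.

Lemma opposite_bound : 8 * (\sum_p \sum_q \sum_r E p q r) <=
  Delta24 #|V| + 24 * (#|V| * #|V|).
Proof.
pose good p q := [exists x, exists y, [&& E p x y, o p q x & o p q y]].
have hit p q r s : E p q r -> E q p s -> let x p q r := E p q r && ~~ good p q in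
    [|| x p q r, x q r p, x r p q, x q p s, x p s q | x s q p].
  move=> epr eqs /=; rewrite epr eqs.
  case: (boolP (good p q)) => [/existsP[x /existsP[y /and3P[e ox oy]]]|//].
  case: (boolP (good q p)) => [/existsP[x' /existsP[y' /and3P[e' ox' oy']]]|].
    by case: (E_opp e ox oy e' ox' oy').
  by rewrite /= !orbT.
apply: leq_trans (deletion_bound E_rot _ hit) _ => [p r|].
  by apply/negP => /E_o; rewrite (o_irr o_or).
rewrite leq_add2l leq_mul2l /= -sum_nat_const leq_sum // => p _.
rewrite exchange_big /= -sum1_card leq_sum // => r _.
(* Of two candidates q and q0, one lies to the left of the line from p through the other, and its
   triangle with p and r shows that the other is good. *)
have [q0 /andP[e0 g0]|nq] := pickP (fun q => E p q r && ~~ good p q); last first.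
  by rewrite big1 // => q _; rewrite nq.
rewrite (bigD1 q0) //= big1 ?addn0 ?leq_b1 // => q qq0; apply/eqP; rewrite eqb0.
apply/negP => /andP[e g].
have [[pq _ _] [pq0 _ _]] := (o_neq o_or (E_o e), o_neq o_or (E_o e0)).
case h: (o p q q0); [case/negP: g|case/negP: g0]; apply/existsP.
  by exists q0; apply/existsP; exists r; rewrite e0 h E_o.
exists q; apply/existsP; exists r; rewrite e (E_o e0) andbT.
by rewrite (o_swap o_or pq0 pq) ?h // eq_sym.
Qed.
End PairwiseMeeting.

(** * Determinants, convex hulls and orientations *)

Section Geometry.
Variable R : realType.
Implicit Types p q r s x : plane R.

(** Twice the signed area of pqr. *)
Definition det p q r : R :=
  (q 0 0 - p 0 0) * (r 0 1 - p 0 1) - (q 0 1 - p 0 1) * (r 0 0 - p 0 0).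

Lemma dotE (u p : plane R) : dot u p = u 0 0 * p 0 0 + u 0 1 * p 0 1.
Proof.
rewrite /dot !big_ord_recl big_ord0 addr0; congr (_ + u _ _ * p _ _);
  exact/val_inj.
Qed.

Lemma plane_eq p q : p 0 0 = q 0 0 -> p 0 1 = q 0 1 -> p = q.
Proof.
move=> e0 e1; apply/rowP => -[[|[|//]] hi].
  by rewrite (_ : Ordinal hi = 0) //; apply/val_inj.
by rewrite (_ : Ordinal hi = 1) //; apply/val_inj.
Qed.

Lemma det_rot p q r : det p q r = det q r p.
Proof. by rewrite /det; ring. Qed.

Lemma det_swap p q r : det p r q = - det p q r.
Proof. by rewrite /det; ring. Qed.

Lemma detpp p q : det p p q = 0.
Proof. by rewrite /det; ring. Qed.

Lemma detpqq p q : det p q q = 0.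
Proof. by rewrite /det; ring. Qed.

Lemma detpqp p q : det p q p = 0.
Proof. by rewrite /det; ring. Qed.

Lemma det_hull p q a b c x y z : a + b + c = 1 ->
  det p q (a *: x + b *: y + c *: z) = a * det p q x + b * det p q y + c * det p q z.
Proof.
move=> h; rewrite /det !mxE; have -> : a = 1 - b - c by lra.
by ring.
Qed.

Lemma collinear_det p q r : collinear p q r -> det p q r = 0.
Proof.
move=> [u [c [u0]]]; rewrite /line /= !dotE => ep eq er.
have h0 : u 0 0 * det p q r = 0.
  have -> : u 0 0 * det p q r =
    (r 0 1 - p 0 1) * ((u 0 0 * q 0 0 + u 0 1 * q 0 1) - (u 0 0 * p 0 0 + u 0 1 * p 0 1))
    - (q 0 1 - p 0 1) * ((u 0 0 * r 0 0 + u 0 1 * r 0 1) - (u 0 0 * p 0 0 + u 0 1 * p 0 1)).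
    by rewrite /det; ring.
  by rewrite ep eq er subrr !mulr0 subrr.
have h1 : u 0 1 * det p q r = 0.
  have -> : u 0 1 * det p q r =
    (q 0 0 - p 0 0) * ((u 0 0 * r 0 0 + u 0 1 * r 0 1) - (u 0 0 * p 0 0 + u 0 1 * p 0 1))
    - (r 0 0 - p 0 0) * ((u 0 0 * q 0 0 + u 0 1 * q 0 1) - (u 0 0 * p 0 0 + u 0 1 * p 0 1)).
    by rewrite /det; ring.
  by rewrite ep eq er subrr !mulr0 subrr.
apply/eqP; apply: contraNT u0 => d0; apply/eqP/rowP => i; rewrite mxE.
move/eqP: h0; move/eqP: h1; rewrite !mulf_eq0 (negPf d0) !orbF => /eqP h1 /eqP h0.
case: i => -[|[|//]] hi; [rewrite -h0|rewrite -h1]; congr (u _ _); exact/val_inj.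
Qed.

Lemma normal_dot p q : exists u : plane R, exists c,
  (p != q -> u != 0) /\ forall x, dot u x - c = det p q x.
Proof.
pose u : plane R := \row_i (if i == 0 then p 0 1 - q 0 1 else q 0 0 - p 0 0).
exists u, (dot u p); split=> [pq|x]; last first.
  by rewrite !dotE /det /u !mxE /=; ring.
apply: contraNneq pq => u0.
have := congr1 (fun v : plane R => v 0 0) u0; have := congr1 (fun v : plane R => v 0 1) u0.
rewrite !mxE /= => /subr0_eq h0 /subr0_eq h1; apply/eqP.
exact: plane_eq.
Qed.

Lemma det_collinear p q r : det p q r = 0 -> collinear p q r.
Proof.
have [<-{q} _|pq d0] := eqVneq p q.
  have [<-{r}|pr] := eqVneq p r.
    exists (const_mx 1), (dot (const_mx 1) p); split=> //.
    by apply/eqP => /rowP/(_ 0); rewrite !mxE => /eqP; rewrite oner_eq0.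
  have [u [c [u0 uE]]] := normal_dot p r.
  by exists u, c; rewrite /line /=; split; first exact: u0;
    apply: subr0_eq; rewrite uE ?detpqp ?detpqq.
have [u [c [u0 uE]]] := normal_dot p q.
by exists u, c; rewrite /line /=; split; first exact: u0;
  apply: subr0_eq; rewrite uE ?detpqp ?detpqq.
Qed.

Lemma hull3_swap p q r : hull3 p q r = hull3 q p r.
Proof.
suff sub (u v w : plane R) : (hull3 u v w `<=` hull3 v u w)%classic by apply/seteqP; split; exact: sub.
move=> x [a [b [c [a0 b0 c0 e ->]]]]; exists b, a, c; split=> //.
  by rewrite -e; ring.
by rewrite (addrC (b *: _)).
Qed.

Lemma hull3_rot p q r : hull3 p q r = hull3 q r p.
Proof.
suff sub (u v w : plane R) : (hull3 u v w `<=` hull3 v w u)%classic.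
  by apply/seteqP; split=> x h; [exact: sub|exact: (sub _ _ _ _ (sub _ _ _ _ h))].
move=> x [a [b [c [a0 b0 c0 e ->]]]]; exists b, c, a; split=> //.
  by rewrite -e; ring.
by rewrite addrC addrA addrC addrA.
Qed.

Lemma hull3_l p q r : hull3 p q r p.
Proof.
by exists 1, 0, 0; rewrite !scale0r scale1r !addr0; split; rewrite ?ler01.
Qed.

Section System.
Variables (P : {fset plane R}) (T : {fset set (plane R)}).
Hypothesis PT : triangle_system P T.
Implicit Types a b c d : P.

Definition ccw a b c := 0 < det (val a) (val b) (val c).

Definition ccw_triangle a b c := ccw a b c && (hull3 (val a) (val b) (val c) \in T).

Lemma det_neq0 a b c : a != b -> a != c -> b != c ->
  det (val a) (val b) (val c) != 0.
Proof.
move=> ab ac bc; have [P3 _] := PT; apply/eqP => d0.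
by apply: (P3 _ _ _ (valP a) (valP b) (valP c)) (det_collinear d0);
  rewrite (inj_eq val_inj).
Qed.

Lemma ccw_orientation : orientation ccw.
Proof.
split; rewrite /ccw.
- by move=> a b c; rewrite det_rot.
- by move=> a b; rewrite detpp ltxx.
- move=> a b c ab ac bc; rewrite (det_swap (val a) (val b)) oppr_gt0 -leNgt.
  by rewrite le_eqVlt eq_sym (negPf (det_neq0 ab ac bc)).
- move=> p q x y s; set p' := val p; set q' := val q; set x' := val x.
  set y' := val y; set s' := val s => qx qy xy xs sy; apply/negP => sq.
  (* The Grassmann-Plücker relation for the vectors from p; under the assumptions all three terms
     are positive. *)
  have : det p' x' y' * det p' s' q' + det p' x' s' * det p' q' y' +
         det p' q' x' * det p' s' y' = 0 by rewrite /det; ring.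
  apply/eqP; rewrite gt_eqF // !addr_gt0 // mulr_gt0 //.
- move=> p q v w r s; set p' := val p; set q' := val q; set v' := val v.
  set w' := val w; set r' := val r; set s' := val s.
  move=> qv qw qr vr rw sq vs; apply/negP => sw.
  (* The cross product of the directions pv and qw. The point r forces it to be positive, so the
     rays converge on the left of pq, and s contradicts this. *)
  pose k := (v' 0 0 - p' 0 0) * (w' 0 1 - q' 0 1) - (v' 0 1 - p' 0 1) * (w' 0 0 - q' 0 0).
  have key x : det p' q' x * k = det p' q' w' * det p' v' x +
      det p' q' v' * (det p' q' w' - det q' w' x) by rewrite /det /k; ring.
  have vr0 : 0 <= det p' v' r'.
    by case/orP: vr => [/eqP rv|/ltW//]; rewrite /r' rv det_rot detpp.
  have wr0 : det q' w' r' <= 0.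
    case/orP: rw => [/eqP e|h]; first by rewrite /r' e det_rot detpp.
    by rewrite det_swap oppr_le0 ltW.
  have k0 : 0 < k.
    rewrite -(pmulr_rgt0 _ qr) key; apply: ltr_wpDl; first exact: mulr_ge0 (ltW _) _.
    by apply: mulr_gt0 => //; rewrite subr_gt0; apply: le_lt_trans qw.
  have : det p' q' s' * k < 0 by rewrite nmulr_rlt0 // det_swap oppr_lt0.
  rewrite key; apply/negP; rewrite -leNgt.
  apply: addr_ge0; apply: mulr_ge0; rewrite ?(ltW qw) ?(ltW qv) ?(ltW vs) //.
  by rewrite subr_ge0 (le_trans _ (ltW qw)) // det_swap oppr_le0 ltW.
Qed.

Lemma ccw_triangle_rot a b c : ccw_triangle a b c = ccw_triangle b c a.
Proof. by rewrite /ccw_triangle (o_rot ccw_orientation) hull3_rot. Qed.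

Lemma ccw_triangle_ccw a b c : ccw_triangle a b c -> ccw a b c.
Proof. by case/andP. Qed.

Lemma ccw_triangleP a b c : ccw_triangle a b c ->
  triangle (val a) (val b) (val c) (hull3 (val a) (val b) (val c)).
Proof. by case/andP => abc _; split=> // /collinear_det d0; rewrite /ccw d0 ltxx in abc. Qed.

Lemma ex_ccw_triangle A : A \in T -> exists a b c,
  ccw_triangle a b c /\ A = hull3 (val a) (val b) (val c).
Proof.
move=> AT; have [_ /(_ A AT)[p [q [r [pP qP rP [ncol AE]]]]]] := PT.
pose a : P := FSetSub pP; pose b : P := FSetSub qP; pose c : P := FSetSub rP.
have d0 : det p q r != 0 by apply: contra_notN ncol => /eqP; apply: det_collinear.
have [h|h] := ltP 0 (det p q r).
  by exists a, b, c; split=> //; rewrite /ccw_triangle /ccw /= h -AE.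
exists b, a, c; rewrite hull3_swap; split=> //.
rewrite /ccw_triangle /ccw /= hull3_swap -AE AT andbT det_rot det_swap oppr_gt0.
by rewrite lt_neqAle d0.
Qed.

Lemma card_ccw_triangle :
  (3 * #|` T| <= \sum_(a : P) \sum_(b : P) \sum_(c : P) ccw_triangle a b c)%N.
Proof.
have /choice[f fP] : forall A : T, exists t : P * P * P,
    ccw_triangle t.1.1 t.1.2 t.2 /\ val A = hull3 (val t.1.1) (val t.1.2) (val t.2).
  by move=> A; have [a [b [c h]]] := ex_ccw_triangle (valP A); exists (a, b, c).
pose rot (t : P * P * P) := (t.1.2, t.2, t.1.1).
pose g (x : T * 'I_3) := iter x.2 rot (f x.1).
pose Q := [set t : P * P * P | ccw_triangle t.1.1 t.1.2 t.2].
have gP (x : T * 'I_3) : g x \in Q /\ val x.1 = hull3 (val (g x).1.1) (val (g x).1.2) (val (g x).2).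
  case: x => A [i i3] /=; rewrite /g /=; elim: i {i3} => [|i [IH IH']] /=.
    by rewrite inE; case: (fP A).
  by rewrite inE /= -ccw_triangle_rot -hull3_rot; rewrite inE in IH.
have g_inj : injective g.
  move=> [A i] [B j] e; have [_ /= hA] := gP (A, i); have [_ /= hB] := gP (B, j).
  have {hA hB} AB : A = B by apply: val_inj; rewrite /= hA hB e.
  subst B; congr (_, _); have [/andP[/(o_neq ccw_orientation)[ab ac bc] _] _] := fP A.
  move: e; rewrite /g /=; case: (f A) ab ac bc => -[a b] c /= ab ac bc.
  case: i => -[|[|[|//]]] hi; case: j => -[|[|[|//]]] hj /= e;
    try (by apply: val_inj); case: e => e1 e2 e3; exfalso;
    by move: ab ac bc; rewrite ?e1 ?e2 ?e3 ?eqxx.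
have <- : #|Q| = (\sum_(a : P) \sum_(b : P) \sum_(c : P) ccw_triangle a b c)%N.
  rewrite pair_bigA pair_bigA /= -sum1_card [LHS]big_mkcond /=.
  by apply: eq_bigr => -[[a b] c] _; rewrite inE; case: ccw_triangle.
have <- : #|{: T * 'I_3}| = (3 * #|` T|)%N by rewrite card_prod card_ord mulnC cardfE.
rewrite -(card_imset _ g_inj); apply/subset_leq_card/fintype.subsetP => t.
by move=> /imsetP[x _ ->]; case: (gP x).
Qed.

Lemma avoid_D1_opposite : ~ contains T (@D1 R) ->
  forall a b c d, ccw_triangle a b c -> ccw_triangle b a d -> False.
Proof.
move=> noD a b c d abc bad; apply: noD.
have [/andP[oc cT] /andP[od dT]] := (abc, bad).
have [ab _ _] := o_neq ccw_orientation oc.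
have [u [k [u0 uE]]] := normal_dot (val a) (val b).
have vab : val a != val b by rewrite (inj_eq val_inj).
have side x : (dot u x < k) = (det (val a) (val b) x < 0).
  by rewrite -uE subr_lt0.
have side' x : (k < dot u x) = (0 < det (val a) (val b) x).
  by rewrite -uE subr_gt0.
have d0 : det (val a) (val b) (val d) < 0.
  by move: od; rewrite /ccw det_rot det_swap oppr_gt0.
exists (hull3 (val b) (val a) (val d)), (hull3 (val a) (val b) (val c)); split=> //.
  apply/eqP => e; have : hull3 (val b) (val a) (val d) (val c).
    by rewrite e hull3_rot hull3_rot; apply: hull3_l.
  move=> [x [y [z [x0 y0 z0 xyz cE]]]]; move: oc; rewrite /ccw cE det_hull //.
  by rewrite detpqq detpqp !mulr0 !add0r ltNge mulr_ge0_le0 // ltW.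
exists (val a), (val b), (val d), (val c); split.
- by have [nc _] := ccw_triangleP bad; split; [|exact: hull3_swap];
    move=> /collinear_det e; rewrite e ltxx in d0.
- exact: ccw_triangleP.
exists u, k; rewrite side side'; split=> //; first exact: u0.
- by apply: subr0_eq; rewrite uE detpqp.
- by apply: subr0_eq; rewrite uE detpqq.
Qed.

(** If neither angle contains the initial ray of the other, the line pc or the line pa separates the
    triangles, and they meet only at p. *)
Lemma avoid_S1_between : ~ contains T (@S1 R) ->
  forall p a b c d : P, ccw_triangle p a b -> ccw_triangle p c d ->
  between ccw p a b c || between ccw p c d a.
Proof.
move=> noS p a b c d pab pcd; apply: contra_notT noS; rewrite negb_or => /andP[nc na].
have [/andP[oab abT] /andP[ocd cdT]] := (pab, pcd).
have [pa pb ab] := o_neq ccw_orientation oab.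
have [pc pd cd] := o_neq ccw_orientation ocd.
set A := hull3 (val p) (val a) (val b); set B := hull3 (val p) (val c) (val d).
have AB : (A `&` B = [set val p])%classic.
  apply/seteqP; split=> [x|_ ->]; last by split; apply: hull3_l.
  move=> [[x0 [x1 [x2 [x0p x1p x2p xs xE]]]] [y0 [y1 [y2 [y0p y1p y2p ys yE]]]]].
  have detx q : det (val p) q x = x1 * det (val p) q (val a) + x2 * det (val p) q (val b).
    by rewrite xE det_hull // detpqp mulr0 add0r.
  have dety q : det (val p) q x = y1 * det (val p) q (val c) + y2 * det (val p) q (val d).
    by rewrite yE det_hull // detpqp mulr0 add0r.
  move: nc na; rewrite /between !negb_or => /and3P[ca cb ncab] /and3P[_ ad nacd].
  have pos u v : p != u -> p != v -> u != v -> ~~ ccw p u v ->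
      0 < det (val p) (val v) (val u).
    by move=> pu pv uv; rewrite (o_swap ccw_orientation) // negbK.
  have null (k l u v : R) : 0 < k -> 0 < l -> 0 <= u -> 0 <= v ->
      0 <= u * - k + v * - l -> u = 0 /\ v = 0.
    move=> k0 l0 u0 v0 h; have uk := mulr_ge0 u0 (ltW k0).
    have vl := mulr_ge0 v0 (ltW l0).
    have /eqP : u * k = 0 by lra.
    have /eqP : v * l = 0 by lra.
    by rewrite !mulf_eq0 (gt_eqF k0) (gt_eqF l0) !orbF => /eqP-> /eqP->.
  have [ac|ac] := boolP (ccw p a c).
    rewrite ac /= in ncab; have bc := pos _ _ pc pb cb ncab.
    have [x10 x20] : x1 = 0 /\ x2 = 0.
      apply: null ac bc x1p x2p _; rewrite -!det_swap -detx dety detpqq mulr0 add0r.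
      exact: mulr_ge0 (ltW ocd).
    have x01 : x0 = 1 by lra.
    by rewrite /= xE x10 x20 x01 scale1r !scale0r !addr0.
  have ac' : a != c by rewrite eq_sym.
  have ca' := pos _ _ pa pc ac' ac; rewrite {1}/ccw ca' /= in nacd.
  have da := pos _ _ pa pd ad nacd.
  have [y10 y20] : y1 = 0 /\ y2 = 0.
    apply: null ca' da y1p y2p _; rewrite -!det_swap -dety detx detpqq mulr0 add0r.
    exact: mulr_ge0 (ltW oab).
  have y01 : y0 = 1 by lra.
  by rewrite /= yE y10 y20 y01 scale1r !scale0r !addr0.
exists A, B; split=> //; last first.
  by exists (val p), (val a), (val b), (val c), (val d); split=> //; exact: ccw_triangleP.
apply/eqP => e; have : A (val a) by rewrite /A hull3_rot; apply: hull3_l.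
have -> : A = (A `&` B)%classic by rewrite -e setIid.
by rewrite AB => /val_inj ap; rewrite ap eqxx in pa.
Qed.

(** The line pq separates the triangles, one touching it only at p and the other only at q. *)
Lemma avoid_M1_opposite : ~ contains T (@M1 R) ->
  forall p q x y x' y' : P, ccw_triangle p x y -> ccw p q x -> ccw p q y ->
  ccw_triangle q x' y' -> ccw q p x' -> ccw q p y' -> False.
Proof.
move=> noM p q x y x' y' pxy qx qy qxy px' py'; apply: noM.
have [/andP[_ AT] /andP[_ BT]] := (pxy, qxy).
exists (hull3 (val p) (val x) (val y)), (hull3 (val q) (val x') (val y')).
suff dis : M1 (hull3 (val p) (val x) (val y)) (hull3 (val q) (val x') (val y')).
  split=> //; apply/eqP => e; move: dis; rewrite /M1 -e setIid => h.
  by have : set0 (val p) by rewrite -h; apply: hull3_l.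
rewrite /M1; apply/seteqP; split=> // z [].
move=> [a [b [c [a0 b0 c0 abc zE]]]] [a' [b' [c' [a0' b0' c0' abc' zE']]]].
have [pq _ _] := o_neq ccw_orientation qx.
have e1 : det (val p) (val q) z = b * det (val p) (val q) (val x) + c * det (val p) (val q) (val y).
  by rewrite zE det_hull // detpqp mulr0 add0r.
have e2 : det (val q) (val p) z = b' * det (val q) (val p) (val x') + c' * det (val q) (val p) (val y').
  by rewrite zE' det_hull // detpqp mulr0 add0r.
have e3 : det (val q) (val p) z = - det (val p) (val q) z by rewrite det_rot det_swap.
have h1 := mulr_ge0 b0 (ltW qx); have h2 := mulr_ge0 c0 (ltW qy).
have h3 := mulr_ge0 b0' (ltW px'); have h4 := mulr_ge0 c0' (ltW py').
have zero (u A : R) : 0 < A -> u * A = 0 -> u = 0.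
  by move=> A0 /eqP; rewrite mulf_eq0 (gt_eqF A0) orbF => /eqP.
have bz : b = 0 by apply: (zero _ _ qx); lra.
have cz : c = 0 by apply: (zero _ _ qy); lra.
have bz' : b' = 0 by apply: (zero _ _ px'); lra.
have cz' : c' = 0 by apply: (zero _ _ py'); lra.
have az : a = 1 by lra.
have az' : a' = 1 by lra.
move: zE'; rewrite zE az bz cz az' bz' cz' !scale1r !scale0r !addr0 => /val_inj e.
by rewrite e eqxx in pq.
Qed.

End System.

Lemma avoiding_bound (P : {fset plane R}) (T : {fset set (plane R)}) (k : nat) : triangle_system P T ->
  (8 * (\sum_(a : P) \sum_(b : P) \sum_(c : P) ccw_triangle T a b c) <=
   Delta24 #|{: P}| + 24 * k)%N -> (#|` T| <= Delta #|` P| + k)%N.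
Proof.
move=> PT h; rewrite DeltaE addnC -divnMDl // leq_divRL // addnC [(k * _)%N]mulnC (cardfE P).
apply: leq_trans h; rewrite mulnC -[24%N]/(8 * 3)%N -mulnA leq_mul2l /=.
exact: card_ccw_triangle.
Qed.

Lemma avoiding_D1_le n m : avoiding_size n (@D1 R) m -> (m <= Delta n)%N.
Proof.
move=> [P [T [<- PT av <-]]]; rewrite -[Delta _]addn0; apply: avoiding_bound => //.
pose x (_ _ _ : P) := false.
have x0 : (\sum_(a : P) \sum_(b : P) \sum_(c : P) x a b c = 0)%N.
  by rewrite big1 // => a _; rewrite big1 // => b _; rewrite big1.
rewrite -[X in (_ + _ * X)%N]x0; apply: (deletion_bound (ccw_triangle_rot PT)) => [a c|a b c d e e'].
  by apply/negP => /ccw_triangle_ccw; rewrite (o_irr (ccw_orientation PT)).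
by case: (avoid_D1_opposite PT av e e').
Qed.

Lemma avoiding_S1_le n m : avoiding_size n (@S1 R) m ->
  (m <= Delta n + n./2 * (n - 2)./2)%N.
Proof.
move=> [P [T [<- PT av <-]]]; apply: avoiding_bound => //.
have := meeting_bound (ccw_orientation PT) (ccw_triangle_rot PT)
  (@ccw_triangle_ccw P T) (avoid_S1_between PT av).
by rewrite -cardfE.
Qed.

Lemma avoiding_M1_le n m : avoiding_size n (@M1 R) m ->
  (m <= Delta n + n * n)%N.
Proof.
move=> [P [T [<- PT av <-]]]; apply: avoiding_bound => //.
have := opposite_bound (ccw_orientation PT) (ccw_triangle_rot PT)
  (@ccw_triangle_ccw P T) (avoid_M1_opposite PT av).
by rewrite -cardfE.
Qed.
End Geometry.

(** * Points on a hyperbola *)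

Section Counting.
Local Open Scope nat_scope.

Definition alternating a b c := odd (a + b) && odd (b + c).

Definition triples n (good : nat -> nat -> nat -> bool) :=
  [set k : 'I_n * 'I_n * 'I_n |
    [&& k.1.1 < k.1.2, k.1.2 < k.2 & good k.1.1 k.1.2 k.2]].

Lemma card_triples n good : #|triples n good| =
  \sum_(0 <= c < n) \sum_(0 <= b < c) \sum_(0 <= a < b) good a b c.
Proof.
have cut k (F : nat -> nat) : k <= n -> \sum_(i < n) (i < k) * F i = \sum_(0 <= i < k) F i.
  move=> kn; rewrite big_mkord (big_ord_widen n F kn) [RHS]big_mkcond /=.
  by apply: eq_bigr => i _; case: ifP; rewrite ?mul1n.
rewrite -sum1_card [LHS]big_mkcond /=.
rewrite (eq_bigr (fun k : 'I_n * 'I_n * 'I_n =>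
    (k.1.2 < k.2) * ((k.1.1 < k.1.2) * good k.1.1 k.1.2 k.2))); last first.
  move=> [[a b] c] _; rewrite inE /=.
  by case: (a < b); case: (b < c); case: (good a b c).
rewrite -(pair_bigA _ (fun (ab : 'I_n * 'I_n) (c : 'I_n) => (ab.2 < c) * ((ab.1 < ab.2) * good ab.1 ab.2 c))) /=.
rewrite -(pair_bigA _ (fun a b : 'I_n => \sum_(c < n) (b < c) * ((a < b) * good a b c))) /=.
rewrite exchange_big /=; under eq_bigr do rewrite exchange_big /=.
rewrite exchange_big /= [RHS]big_mkord; apply: eq_bigr => c _.
rewrite -[RHS](cut c) ?(ltnW (ltn_ord c)) //; apply: eq_bigr => b _.
rewrite -[X in _ = _ * X](cut b) ?(ltnW (ltn_ord b)) // big_distrr /=.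
by apply: eq_bigr => a _.
Qed.

Lemma sum_odd_shift b e :
  \sum_(0 <= a < b) odd (a + e) = if odd e then uphalf b else b./2.
Proof.
elim: b => [|b IH]; first by rewrite big_nil if_same.
by rewrite big_nat_recr //= IH oddD; case: (odd e); lia.
Qed.

Lemma sum_uphalf_shift c e : 2 * \sum_(0 <= b < c) odd (b + e) * uphalf b =
  if odd e then uphalf c * (uphalf c).-1 else c./2 * (c./2).+1.
Proof.
elim: c => [|c IH]; first by rewrite big_nil if_same.
rewrite big_nat_recr //= mulnDr IH oddD uphalf_half.
by case: (odd e); case: (odd c) => /=; move: c./2 => [|k] //=; nia.
Qed.

Lemma sum_alternating c :
  2 * \sum_(0 <= b < c) \sum_(0 <= a < b) alternating a b c = c./2 * (c./2).+1.
Proof.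
rewrite (eq_big_nat _ _ (F2 := fun b => odd (b + c) * uphalf b)) => [|b _].
  by rewrite sum_uphalf_shift; case: ifP => // oc; rewrite uphalf_half oc mulnC.
rewrite /alternating (eq_bigr (fun a => odd (b + c) * odd (a + b))); last first.
  by move=> a _; rewrite mulnC mulnb.
rewrite -big_distrr /= sum_odd_shift uphalf_half.
by case: (odd b); rewrite ?add0n.
Qed.

Lemma sum_Delta24 n :
  24 * \sum_(0 <= c < n) \sum_(0 <= b < c) \sum_(0 <= a < b) alternating a b c
  = Delta24 n.
Proof.
elim: n => [|n IH]; first by rewrite big_nil.
rewrite big_nat_recr //= mulnDr IH -[24]/(12 * 2) -mulnA sum_alternating.
rewrite /Delta24 /=; have := odd_double_half n; move: n./2 => k.
case: (odd n) => <-; rewrite -muln2 /=; last by case: k => [|k]; nia.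
have -> : 1 + k * 2 - 1 = k * 2 by lia.
have -> : (1 + k * 2).+1 - 2 = k * 2 by lia.
nia.
Qed.

(** The extra cases contain a pair 2i, 2i+1, whose points will be antipodal, so that the origin lies
    on a side. *)
Definition paired a b c :=
  [|| alternating a b c, (b == a.+1) && ~~ odd a | (c == b.+1) && ~~ odd b].

Lemma sum_pair b : \sum_(0 <= a < b) ((b == a.+1) && ~~ odd a) = odd b.
Proof.
case: b => [|b]; first by rewrite big_nil.
rewrite big_nat_recr //= eqxx big1_seq //= => a; rewrite mem_index_iota => /andP[_ ab].
by rewrite eqSS gtn_eqF.
Qed.

Lemma sum_paired c :
  \sum_(0 <= b < c) \sum_(0 <= a < b) paired a b c =
  \sum_(0 <= b < c) \sum_(0 <= a < b) alternating a b c + odd c * c.-1.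
Proof.
(* The three terms are disjoint: the last two keep only the non-alternating triples, and they need b
   odd and b even respectively. *)
have split3 a b : paired a b c = alternating a b c +
    odd c * ((b == a.+1) && ~~ odd a) + ((c == b.+1) && ~~ odd b) * odd (a + 1) :> nat.
  rewrite /paired /alternating !oddD.
  case: (eqVneq b a.+1) => [->|_] /=; case: (eqVneq c _) => [->|_] /=;
  by case: (odd a); case: (odd b); case: (odd c).
under eq_bigr => b _ do under eq_bigr => a _ do rewrite split3.
under eq_bigr => b _ do
  rewrite !big_split /= -!big_distrr /= sum_pair (sum_odd_shift b 1).
rewrite !big_split /= -big_distrr /= -addnA; congr (_ + _).
under eq_bigr => b _ do rewrite -[b in odd b]addn0.
rewrite (sum_odd_shift c 0) /=; case: c split3 => [|c] _; first by rewrite big_nil.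
rewrite big_nat_recr //= eqxx big1_seq => [|b]; last first.
  by rewrite mem_index_iota => /andP[_ bc]; rewrite eqSS gtn_eqF.
rewrite !uphalf_half; case oc: (odd c) => //=; rewrite !add0n.
by have := odd_double_half c; rewrite oc; lia.
Qed.

Lemma sum_paired_total n :
  \sum_(0 <= c < n) \sum_(0 <= b < c) \sum_(0 <= a < b) paired a b c =
  Delta n + n %/ 2 * ((n - 2) %/ 2).
Proof.
under eq_bigr => c _ do rewrite sum_paired.
rewrite big_split /=; congr (_ + _).
  by rewrite DeltaE -sum_Delta24 mulKn.
have -> : (n - 2) %/ 2 = n./2.-1 by lia.
rewrite divn2; elim: n => [|n IH]; first by rewrite big_nil.
rewrite big_nat_recr //= IH uphalf_half; have := odd_double_half n.
by move: n./2 => k; case: (odd n) => <-; rewrite -muln2; case: k => [|k]; nia.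
Qed.
End Counting.

(** * Triangles on the hyperbola containing the origin *)

Section Construction.
Variable R : realType.
Implicit Types p q r x y z : plane R.

(** On the hull, the barycentric coordinate of p is at most 1, with equality only at p. Writing p as
    a convex combination of x, y, z thus forces one of them to be p. *)
Lemma hull3_vertex p q r x y z : ~ collinear p q r ->
  hull3 p q r = hull3 x y z -> p = x \/ p = y \/ p = z.
Proof.
move=> ncol e; have d0 : det p q r != 0 by apply: contra_notN ncol => /eqP /det_collinear.
have weight w : hull3 p q r w -> exists a, [/\ a <= 1, det q r w = a * det p q r & a = 1 -> p = w].
  move=> [a [b [c [a0 b0 c0 abc ->]]]]; exists a; split; first by lra.
    by rewrite det_hull // detpqp detpqq !mulr0 !addr0 -det_rot.
  move=> a1; have b1 : b = 0 by lra.
  have c1 : c = 0 by lra.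
  by rewrite a1 b1 c1 scale1r !scale0r !addr0.
have hx : hull3 p q r x by rewrite e; apply: hull3_l.
have hy : hull3 p q r y by rewrite e hull3_rot; apply: hull3_l.
have hz : hull3 p q r z by rewrite e -hull3_rot; apply: hull3_l.
have [a1 [a1l a1E a1P]] := weight _ hx; have [a2 [a2l a2E a2P]] := weight _ hy.
have [a3 [a3l a3E a3P]] := weight _ hz.
have : hull3 x y z p by rewrite -e; apply: hull3_l.
move=> [a [b [c [a0 b0 c0 abc pE]]]].
have : det q r p = (a * a1 + b * a2 + c * a3) * det p q r.
  by rewrite {1}pE det_hull // a1E a2E a3E; ring.
rewrite -det_rot -{1}[det p q r]mul1r => /(mulIf d0) s1.
have h1 : 0 <= a * (1 - a1) by apply: mulr_ge0 => //; rewrite subr_ge0.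
have h2 : 0 <= b * (1 - a2) by apply: mulr_ge0 => //; rewrite subr_ge0.
have h3 : 0 <= c * (1 - a3) by apply: mulr_ge0 => //; rewrite subr_ge0.
have [z1 [z2 z3]] : a * (1 - a1) = 0 /\ b * (1 - a2) = 0 /\ c * (1 - a3) = 0.
  by split; [lra|split; lra].
move/eqP: z1; move/eqP: z2; move/eqP: z3; rewrite !mulf_eq0 !subr_eq0.
case/orP => [/eqP c1|/eqP/esym/a3P ->]; last by right; right.
case/orP => [/eqP b1|/eqP/esym/a2P ->]; last by right; left.
case/orP => [/eqP a10|/eqP/esym/a1P ->]; last by left.
by move: abc; rewrite a10 b1 c1 !addr0 => /eqP; rewrite eq_sym oner_eq0.
Qed.

Lemma dot_hull (u : plane R) a b c p q r :
  dot u (a *: p + b *: q + c *: r) = a * dot u p + b * dot u q + c * dot u r.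
Proof. by rewrite !dotE !mxE; ring. Qed.

(** The hyperbola is centrally symmetric, with antipodal parameters t and -t, and no line meets it
    in three points. *)
Definition hyp (t : R) : plane R := \row_j (if j == 0 then t else t^-1).

Lemma hyp_det s t u : s != 0 -> t != 0 -> u != 0 ->
  det (hyp s) (hyp t) (hyp u) = (t - s) * (s - u) * (t - u) / (s * t * u).
Proof. by move=> s0 t0 u0; rewrite /det !mxE /=; field; rewrite s0 t0 u0. Qed.

Variables (tau : nat -> nat) (good : nat -> nat -> nat -> bool) (n : nat).
Hypothesis tau_gt0 : forall i, (0 < tau i)%N.
Hypothesis tau_mono : forall i j, (i <= j)%N -> (tau i <= tau j)%N.
Hypothesis tau_strict : forall i j, (i < j)%N -> odd i = odd j -> (tau i < tau j)%N.

Let t i : R := (-1) ^+ (odd i) * (tau i)%:R.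
Let pt i : plane R := hyp (t i).

Lemma t_neq0 i : t i != 0.
Proof. by rewrite mulf_eq0 signr_eq0 pnatr_eq0 -lt0n tau_gt0. Qed.

Lemma t_inj i j : t i = t j -> i = j.
Proof.
move=> e; have : odd i = odd j /\ tau i = tau j.
  move: e; rewrite /t; case: (odd i); case: (odd j);
    rewrite ?expr0 ?expr1 ?mul1r ?mulN1r => /eqP.
  - by rewrite eqr_opp eqr_nat => /eqP.
  - by rewrite eqr_oppLR -addr_eq0 -natrD pnatr_eq0 addn_eq0 -!leqn0 leqNgt tau_gt0.
  - by rewrite -addr_eq0 -natrD pnatr_eq0 addn_eq0 -!leqn0 leqNgt tau_gt0.
  - by rewrite eqr_nat => /eqP.
move=> [o e']; case: (ltngtP i j) => // ij.
  by have := tau_strict ij o; rewrite e' ltnn.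
by have := tau_strict ij (esym o); rewrite e' ltnn.
Qed.

Lemma pt_inj i j : pt i = pt j -> i = j.
Proof. by move=> /(congr1 (fun v : plane R => v 0 0)); rewrite !mxE /=; apply: t_inj. Qed.

Lemma pt_ncol i j k : i != j -> i != k -> j != k -> ~ collinear (pt i) (pt j) (pt k).
Proof.
move=> ij ik jk /collinear_det; rewrite hyp_det ?t_neq0 //.
have ne a b : a != b -> t a - t b != 0 by rewrite subr_eq0; apply: contraNneq => /t_inj/eqP.
have ji : j != i by rewrite eq_sym.
apply/eqP; apply: mulf_neq0; last first.
  by apply: invr_neq0; apply: mulf_neq0; [apply: mulf_neq0|]; apply: t_neq0.
by apply: mulf_neq0; [apply: mulf_neq0|]; apply: ne.
Qed.

Definition points := [fset pt (val i) | i in 'I_n]%fset.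

Definition hulls := [fset hull3 (pt k.1.1) (pt k.1.2) (pt k.2) |
  k : 'I_n * 'I_n * 'I_n in triples n good]%fset.

Lemma card_hulls : #|` hulls| = #|triples n good|.
Proof.
rewrite card_in_imfset /= -?cardE // => -[[a b] c] [[a' b'] c'].
rewrite !inE /= => /and3P[ab bc _] /and3P[ab' bc' _] e.
have ncol : ~ collinear (pt a) (pt b) (pt c).
  by apply: pt_ncol; rewrite ?neq_ltn ?ab ?bc ?(ltn_trans ab bc).
have ncol' : ~ collinear (pt b) (pt c) (pt a).
  by apply: pt_ncol; rewrite ?neq_ltn ?ab ?bc ?(ltn_trans ab bc) ?orbT.
have ncol'' : ~ collinear (pt c) (pt a) (pt b).
  by apply: pt_ncol; rewrite ?neq_ltn ?ab ?bc ?(ltn_trans ab bc) ?orbT.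
have in3 i : pt i = pt a' \/ pt i = pt b' \/ pt i = pt c' ->
    i = a' \/ i = b' \/ i = c' :> nat.
  by case=> [|[]] /pt_inj ->; auto.
have := in3 _ (hull3_vertex ncol e).
have := in3 b (hull3_vertex ncol' _); rewrite -hull3_rot => /(_ e).
have := in3 c (hull3_vertex ncol'' _); rewrite hull3_rot => /(_ e).
move=> ha hb hc; suff [ea [eb ec]] : a = a' :> nat /\ b = b' :> nat /\ c = c' :> nat.
  by congr (_, _, _); apply: val_inj.
by lia.
Qed.

Lemma hullsP A : A \in hulls -> exists a b c : 'I_n,
  [/\ (a < b)%N, (b < c)%N, good a b c & A = hull3 (pt a) (pt b) (pt c)].
Proof.
by move=> /imfsetP[[[a b] c]] /=; rewrite inE => /and3P[/= ab bc g] ->; exists a, b, c.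
Qed.

Lemma pt_triangle a b c : (a < b)%N -> (b < c)%N ->
  triangle (pt a) (pt b) (pt c) (hull3 (pt a) (pt b) (pt c)).
Proof.
by move=> ab bc; split=> //; apply: pt_ncol; rewrite neq_ltn ?ab ?bc ?(ltn_trans ab bc).
Qed.

Lemma hulls_avoiding F : ~ contains hulls F ->
  avoiding_size n F #|triples n good|.
Proof.
move=> av; exists points, hulls; split=> //; last exact: card_hulls.
- by rewrite card_imfset /= ?size_enum_ord // => i j /pt_inj/val_inj.
- split=> [p q r|A /hullsP[a [b [c [ab bc _ ->]]]]].
    move=> /imfsetP[i _ ->] /imfsetP[j _ ->] /imfsetP[k _ ->] ij ik jk.
    by apply: pt_ncol; [apply: contraNneq ij|apply: contraNneq ik|apply: contraNneq jk] => ->.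
  exists (pt a), (pt b), (pt c); split; try exact: in_imfset.
  exact: pt_triangle.
Qed.

Lemma alternating_origin a b c : (a < b)%N -> (b < c)%N -> alternating a b c ->
  exists x y z : R, [/\ 0 <= x, 0 <= y, 0 <= z, x + y + z = 1 &
    0 = x *: pt a + y *: pt b + z *: pt c] /\
    ((tau a < tau b)%N -> (tau b < tau c)%N -> [/\ 0 < x, 0 < y & 0 < z]).
Proof.
move=> ab bc /andP[]; rewrite !oddD => oab obc.
have ac : (tau a < tau c)%N.
  apply: tau_strict; first exact: ltn_trans bc.
  by move: oab obc; case: (odd a); case: (odd b); case: (odd c).
pose s : R := (-1) ^+ (odd a).
pose A : R := (tau a)%:R; pose B : R := (tau b)%:R; pose C : R := (tau c)%:R.
have [A0 B0 C0] : [/\ 0 < A, 0 < B & 0 < C] by rewrite !ltr0n !tau_gt0.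
have AB : A <= B by rewrite ler_nat tau_mono // ltnW.
have BC : B <= C by rewrite ler_nat tau_mono // ltnW.
have AC : A < C by rewrite ltr_nat.
have s2 : s * s = 1 by rewrite -expr2 sqrr_sign.
have s0 : s != 0 by rewrite signr_eq0.
have sV : s^-1 = s by rewrite -[RHS]mul1r -(mulVf s0) -mulrA s2 mulr1.
have ta : t a = s * A by [].
have tb : t b = - (s * B).
  by rewrite /t -mulNr; congr (_ * _); move: oab; rewrite /s;
    case: (odd a); case: (odd b) => //; rewrite ?expr1 ?expr0 ?opprK.
have tc : t c = s * C.
  by rewrite /t; congr (_ * _); move: oab obc; rewrite /s;
    case: (odd a); case: (odd b); case: (odd c).
(* Unnormalised barycentric coordinates of the origin, solving XA - YB + ZC = 0 and X/A - Y/B + Z/C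
   = 0. *)
pose X := A * (C ^+ 2 - B ^+ 2); pose Y := B * (C ^+ 2 - A ^+ 2).
pose Z := C * (B ^+ 2 - A ^+ 2); pose S := X + Y + Z.
have sq (u v : R) : 0 < u -> u <= v -> 0 <= v ^+ 2 - u ^+ 2.
  by move=> u0 uv; rewrite subr_ge0; nra.
have sq' (u v : R) : 0 < u -> u < v -> 0 < v ^+ 2 - u ^+ 2.
  by move=> u0 uv; rewrite subr_gt0; nra.
have X0 : 0 <= X by apply: mulr_ge0; [exact: ltW|exact: sq].
have Y0 : 0 < Y by apply: mulr_gt0 => //; exact: sq'.
have Z0 : 0 <= Z by apply: mulr_ge0; [exact: ltW|exact: sq].
have S0 : 0 < S by rewrite /S; lra.
exists (X / S), (Y / S), (Z / S); split.
  split; rewrite ?divr_ge0 ?(ltW S0) ?(ltW Y0) //.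
    by rewrite -!mulrDl divff // gt_eqF.
  apply: plane_eq; rewrite !mxE /= ?ta ?tb ?tc ?invrN ?invfM ?sV.
    by rewrite /X /Y /Z; field; rewrite gt_eqF.
  by rewrite /X /Y /Z; field; rewrite !gt_eqF.
rewrite -!(ltr_nat R) -/A -/B -/C => AB' BC'; split; apply: divr_gt0 => //.
  by apply: mulr_gt0 => //; exact: sq'.
by apply: mulr_gt0 => //; exact: sq'.
Qed.

Lemma hulls_avoid_S1 : (forall A, A \in hulls -> A 0) -> ~ contains hulls (@S1 R).
Proof.
move=> h0 [A [B [AT BT _ [p [q [r [_ [_ [tA _ AB]]]]]]]]].
have p0 : 0 = p.
  have : (A `&` B)%classic 0 by split; apply: h0.
  by rewrite AB.
have [a [b [c [_ _ _ AE]]]] := hullsP AT; have [ncol E] := tA.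
have pt0 i : p <> pt i.
  rewrite -p0 => /(congr1 (fun v : plane R => v 0 0)); rewrite !mxE /= => /esym/eqP.
  by rewrite (negPf (t_neq0 _)).
by have [|[]] := hull3_vertex ncol (etrans (esym E) AE); apply: pt0.
Qed.

Lemma hulls_avoid_M1 : (forall A, A \in hulls -> A 0) -> ~ contains hulls (@M1 R).
Proof.
move=> h0 [A [B [AT BT _]]]; rewrite /M1 => AB.
by have : set0 (0 : plane R) by rewrite -AB; split; apply: h0.
Qed.

(** Two triangles on opposite sides of a line share only points of that line, so the origin would
    lie on it. Being interior, it would force all three vertices onto the line. *)
Lemma hulls_avoid_D1 : (forall i j, (i < j)%N -> (tau i < tau j)%N) ->
  (forall a b c, good a b c -> alternating a b c) -> ~ contains hulls (@D1 R).
Proof.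
move=> tau_lt good_alt [A [B [AT BT _]]].
have org K : K \in hulls -> exists (a b c : nat) (x y z : R), [/\ (a < b)%N /\ (b < c)%N,
    K = hull3 (pt a) (pt b) (pt c), [/\ 0 < x, 0 < y & 0 < z], x + y + z = 1 &
    0 = x *: pt a + y *: pt b + z *: pt c].
  move=> /hullsP[a [b [c [ab bc g ->]]]].
  have [x [y [z [[_ _ _ s e] pos]]]] := alternating_origin ab bc (good_alt _ _ _ g).
  by exists a, b, c, x, y, z; split=> //; apply: pos; apply: tau_lt.
have org0 K : K \in hulls -> K 0.
  move=> /org[a [b [c [x [y [z [_ -> [x0 y0 z0] s e]]]]]]].
  by exists x, y, z; split=> //; exact: ltW.
move=> [p [q [r [s [[_ AE] [_ BE] [u [k [u0 up uq ur us]]]]]]]].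
have dot0 : dot u 0 = 0 by rewrite dotE !mxE !mulr0 addr0.
have Ak v : A v -> dot u v <= k.
  rewrite AE => -[x [y [z [x0 y0 z0 xyz ->]]]]; rewrite dot_hull up uq.
  have ek : x * k + y * k + z * k = k by rewrite -!mulrDl xyz mul1r.
  by rewrite -[leRHS]ek lerD2l ler_wpM2l // ltW.
have Bk v : B v -> k <= dot u v.
  rewrite BE => -[x [y [z [x0 y0 z0 xyz ->]]]]; rewrite dot_hull up uq.
  have ek : x * k + y * k + z * k = k by rewrite -!mulrDl xyz mul1r.
  by rewrite -[leLHS]ek lerD2l ler_wpM2l // ltW.
have := Ak _ (org0 _ AT); have := Bk _ (org0 _ BT); rewrite dot0 => kle kge.
have k0 : k = 0 by apply/eqP; rewrite eq_le kle kge.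
rewrite {}k0 in Ak up uq ur us Bk.
have [a [b [c [x [y [z [[ab bc] Kabc [x0 y0 z0] _ e]]]]]]] := org A AT.
have da : dot u (pt a) <= 0 by apply: Ak; rewrite Kabc; apply: hull3_l.
have db : dot u (pt b) <= 0 by apply: Ak; rewrite Kabc hull3_rot; apply: hull3_l.
have dc : dot u (pt c) <= 0 by apply: Ak; rewrite Kabc -hull3_rot; apply: hull3_l.
move: dot0; rewrite e dot_hull => dot0.
have xa : x * dot u (pt a) <= 0 by rewrite pmulr_rle0.
have yb : y * dot u (pt b) <= 0 by rewrite pmulr_rle0.
have zc : z * dot u (pt c) <= 0 by rewrite pmulr_rle0.
have zero (v d : R) : 0 < v -> v * d = 0 -> d = 0.
  by move=> v0 /eqP; rewrite mulf_eq0 (gt_eqF v0) => /eqP.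
have [ncol _] := pt_triangle ab bc; apply: ncol; exists u, 0; split=> //.
- by apply: (zero x) => //; move: dot0 xa yb zc; clear; lra.
- by apply: (zero y) => //; move: dot0 xa yb zc; clear; lra.
- by apply: (zero z) => //; move: dot0 xa yb zc; clear; lra.
Qed.
End Construction.

Lemma D1_construction (R : realType) n : avoiding_size n (@D1 R) (Delta n).
Proof.
have -> : Delta n = #|triples n alternating|.
  by rewrite card_triples DeltaE -sum_Delta24 mulKn.
(* Here [tau] is the successor function: strictly increasing, so the origin is interior to every
   triangle. *)
by apply: (@hulls_avoiding R S) => //; apply: hulls_avoid_D1.
Qed.

Section PairedConstruction.
Variables (R : realType) (n : nat).

(** Indices 2i and 2i+1 get the same modulus with opposite signs, hence antipodal points; the
    successor keeps the modulus positive. *)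
Let tau i := i./2.+1.

Let tau_gt0 i : (0 < tau i)%N. Proof. by []. Qed.

Let tau_mono i j : (i <= j)%N -> (tau i <= tau j)%N.
Proof. by rewrite /tau; lia. Qed.

Let tau_strict i j : (i < j)%N -> odd i = odd j -> (tau i < tau j)%N.
Proof. by rewrite /tau; lia. Qed.

Lemma paired_origin A : A \in hulls R tau paired n -> A 0.
Proof.
pose t i : R := (-1) ^+ (odd i) * (tau i)%:R.
have opp i : ~~ odd i -> hyp (t i) + hyp (t i.+1) = 0.
  move=> oi; have -> : t i.+1 = - t i.
    by rewrite /t /tau /= (negPf oi) uphalf_half (negPf oi) mulN1r mul1r.
  by apply: plane_eq; rewrite !mxE /= ?invrN addrN.
have half1 : 2^-1 + 2^-1 = 1 :> R by field.
have half0 : 0 <= 2^-1 :> R by rewrite invr_ge0.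
move=> /hullsP[a [b [c [ab bc /or3P[alt|/andP[/eqP bE oa]|/andP[/eqP cE ob]] ->]]]].
- have [x [y [z [[x0 y0 z0 s e] _]]]] :=
    alternating_origin R tau_gt0 tau_mono tau_strict ab bc alt.
  by exists x, y, z.
- exists 2^-1, 2^-1, 0; rewrite addr0; split=> //.
  by rewrite bE scale0r addr0 -scalerDr opp // scaler0.
- exists 0, 2^-1, 2^-1; rewrite add0r; split=> //.
  by rewrite cE scale0r add0r -scalerDr opp // scaler0.
Qed.

Lemma S1_construction :
  avoiding_size n (@S1 R) (Delta n + n %/ 2 * ((n - 2) %/ 2))%N.
Proof.
rewrite -sum_paired_total -card_triples.
apply: (@hulls_avoiding R tau) => //.
by apply: hulls_avoid_S1 => // A; apply: paired_origin.
Qed.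

Lemma M1_construction :
  avoiding_size n (@M1 R) (Delta n + n %/ 2 * ((n - 2) %/ 2))%N.
Proof.
rewrite -sum_paired_total -card_triples.
apply: (@hulls_avoiding R tau) => //.
by apply: hulls_avoid_M1 => // A; apply: paired_origin.
Qed.
End PairedConstruction.

Theorem theorem3 (R : realType) :
  [/\ forall n : nat, (3 <= n)%N -> turan n (@D1 R) = Delta n,
      forall n : nat, (3 <= n)%N ->
        turan n (@S1 R) = (Delta n + (n %/ 2) * ((n - 2) %/ 2))%N &
      exists c C : R, [/\ 0 < c, 0 < C &
        exists N : nat, forall n : nat, (N <= n)%N -> (3 <= n)%N ->
          c * n%:R ^+ 2 <= (turan n (@M1 R))%:R - (Delta n)%:R <= C * n%:R ^+ 2]].
Proof.
split=> [n _|n _|].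
- have [av mx] := turanP n (@D1 R); apply/eqP; rewrite eqn_leq.
  by rewrite (avoiding_D1_le av) mx //; apply: D1_construction.
- have [av mx] := turanP n (@S1 R); apply/eqP; rewrite eqn_leq.
  by rewrite (mx _ (S1_construction R n)) andbT !divn2 (avoiding_S1_le av).
(* The upper constant 1 comes from [avoiding_M1_le]. For the lower one, with n/2 = k + 1 and n at
   most 2k + 3, the inequality (2k + 3)^2 <= 16 k(k + 1) holds once k is at least 1. *)
exists 16%:R^-1, 1; split; rewrite ?invr_gt0 ?ltr0n //.
exists 5%N => n n5 _; have [av mx] := turanP n (@M1 R).
have lo := mx _ (M1_construction R n); have hi := avoiding_M1_le av.
set m := turan n (@M1 R) in lo hi *; apply/andP; split; last first.
  by rewrite mul1r lerBlDl -natrX -natrD ler_nat -mulnn.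
have q : (n * n <= 16 * (m - Delta n))%N.
  have : (n * n <= 16 * (n %/ 2 * ((n - 2) %/ 2)))%N.
    have [k nk] : exists k, (n %/ 2 = k.+1)%N by exists (n %/ 2).-1%N; lia.
    have -> : ((n - 2) %/ 2 = k)%N by lia.
    have : (n <= k.+1 * 2 + 1)%N by lia.
    rewrite nk; nia.
  by move: lo; lia.
have Dm : (Delta n <= m)%N by apply: leq_trans lo; apply: leq_addr.
rewrite -natrB // -natrX ler_pdivrMl ?ltr0n // -natrM ler_nat -mulnn.
exact: q.
Qed.
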